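(* Let $\lambda$ be a partition with $\ell(\lambda)$ parts, and let $\mathsf{CS}(\lambda)_{\ell(\lambda)}$ be the induced subgraph of $\mathsf{CS}(\lambda)$ on the vertices $T$ with $\mathsf{Des}(T)$ having exactly $\ell(\lambda)$ parts. Then $\mathsf{CS}(\lambda)_{\ell(\lambda)}$ is isomorphic to the crystal graph $B(\lambda)_{\ell(\lambda)}$. Under this isomorphism, a vertex $T$ with $\alpha=\mathsf{Des}(T)$ is mapped to the tableau $b$ obtained from $T$ by replacing every entry of $\alpha^{(i)}$ by $i$ (for all $i$), so that $\mathsf{Des}(T)$ becomes the weight of $b$; and an edge $T\xrightarrow{I}T'$ with $I=[i,i+2m]$, $I^-=[i,i+m-1]$, $I^+=[i+m+1,i+2m]$, $I^-\cup\{i+m\}\subseteq\alpha^{(j)}$ and $I^+\subseteq\alpha^{(j+1)}$ becomes the crystal edge $b\xrightarrow{j}b'$, i.e. $b'=f_j(b)$.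
   Context: French notation; $|\lambda|=N$; $\mathsf{SYT}(\lambda)$ standard tableaux; $\mathsf{SSYT}(\lambda)_n$ semistandard tableaux with entries in $[n]$; $\mathsf{row}(b)$ reads rows left to right from top row to bottom row; $\mathsf{std}$ replaces the $a_j$ entries $j$, in reading order, by $a_1+\dots+a_{j-1}+1,\dots,a_1+\dots+a_j$. The crystal graph $B(\lambda)_n$ has vertex set $\mathsf{SSYT}(\lambda)_n$ and edges $b\xrightarrow{j}f_j(b)$, where in the subword of $\mathsf{row}(b)$ of letters $j,j+1$ each $j+1$ is bracketed with an unbracketed $j$ to its right (parenthesis matching) and $f_j$ changes the rightmost unbracketed $j$ to $j+1$ (no edge if none); the weight of $b$ is $(a_1,\dots,a_n)$ with $a_j$ the number of entries $j$. For a permutation $\pi$ of $[N]$ and $I=[i,i+2m]\subseteq[N]$, $m\ge1$, $I$ is a Dyck pattern interval of $\pi$ if the RSK insertion tableau of the subword $\pi|_I$ has bottom row $i,\dots,i+m$ and top row $i+m+1,\dots,i+2m$; a Dyck pattern interval of $T$ is one of $\mathsf{row}(T)$. The crystal skeleton $\mathsf{CS}(\lambda)$ is the directed graph on $\mathsf{SYT}(\lambda)$ with, for each Dyck pattern interval $I=[i,i+2m]$ of $T$, an edge $T\xrightarrow{I}\mathsf{std}(f_i(c))$, $c$ obtained from $T$ by replacing entries $i,\dots,i+m$ by $i$ and $i+m+1,\dots,i+2m$ by $i+1$. Descent composition: $d$ is a descent of $T$ if $d+1$ lies in a strictly higher row; for descents $d_1<\dots<d_k$, $\mathsf{Des}(T)=(d_1,d_2-d_1,\dots,N-d_k)$;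 for a composition $\alpha$, $\alpha^{(j)}=\{\alpha_1+\dots+\alpha_{j-1}+1,\dots,\alpha_1+\dots+\alpha_j\}$. *)

(* Defs.v *)
(* Tableaux are seq (seq nat), listed row by row from the
   BOTTOM row (row 0, longest) upwards: French notation. *)
From mathcomp Require Import all_boot.
Set Implicit Arguments. Unset Strict Implicit. Unset Printing Implicit Defensive.

Definition tableau := seq (seq nat).

Definition is_partition (lam : seq nat) : bool :=
  sorted geq lam && all (fun p => 0 < p) lam.

Definition shape (t : tableau) : seq nat := map size t.

Definition is_ssyt (t : tableau) : bool :=
  all (sorted leq) t &&
  all (fun r => all (fun c => nth 0 (nth [::] t r) c < nth 0 (nth [::] t r.+1) c)
                    (iota 0 (size (nth [::] t r.+1))))
      (iota 0 (size t)).

Definition is_SSYT (lam : seq nat) (n : nat) (b : tableau) : bool :=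
  [&& shape b == lam, is_ssyt b & all (fun x => 0 < x <= n) (flatten b)].

Definition is_SYT (lam : seq nat) (T : tableau) : bool :=
  [&& shape T == lam, is_ssyt T & perm_eq (flatten T) (iota 1 (sumn lam))].

Definition rowword (t : tableau) : seq nat := flatten (rev t).

Definition tab_of_word (sh : seq nat) (w : seq nat) : tableau :=
  rev (reshape (rev sh) w).

(* crystal operator f_j on words: letters j+1 are '(' and letters j are ')';
   f_j changes the rightmost unbracketed j into j+1. *)
Fixpoint fpos (j : nat) (w : seq nat) (i open : nat) (best : option nat)
  : option nat :=
  match w with
  | [::] => best
  | x :: w' =>
      if x == j.+1 then fpos j w' i.+1 open.+1 best
      else if x == j then
        (if open is k.+1 then fpos j w' i.+1 k best
         else fpos j w' i.+1 0 (Some i))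
      else fpos j w' i.+1 open best
  end.

Definition f_word (j : nat) (w : seq nat) : option (seq nat) :=
  omap (fun p => set_nth 0 w p j.+1) (fpos j w 0 0 None).

Definition f_tab (j : nat) (t : tableau) : option tableau :=
  omap (tab_of_word (shape t)) (f_word j (rowword t)).

Definition std_word (w : seq nat) : seq nat :=
  [seq count (fun y => y < nth 0 w p) w + count (pred1 (nth 0 w p)) (take p.+1 w)
  | p <- iota 0 (size w)].

Definition std_tab (t : tableau) : tableau :=
  tab_of_word (shape t) (std_word (rowword t)).

(* RSK row insertion; rows listed bottom first (French), so the first row
   is the bottom row. *)
Fixpoint ins_rows (t : tableau) (x : nat) : tableau :=
  match t with
  | [::] => [:: [:: x]]
  | r :: t' =>
      let k := find (fun y => x < y) r in
      if k < size r then set_nth 0 r k x :: ins_rows t' (nth 0 r k)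
      else rcons r x :: t'
  end.

Definition rsk_P (w : seq nat) : tableau := foldl ins_rows [::] w.

Definition dyck_interval (pi : seq nat) (i m : nat) : bool :=
  [&& 0 < m, 0 < i, i + 2 * m <= size pi &
   rsk_P [seq x <- pi | i <= x <= i + 2 * m] == [:: iota i m.+1; iota (i + m).+1 m]].

Definition collapse (i m : nat) (T : tableau) : tableau :=
  map (map (fun x => if i <= x <= i + m then i
                     else if i + m < x <= i + 2 * m then i.+1 else x)) T.

Definition cs_edge (T : tableau) (i m : nat) (T' : tableau) : Prop :=
  dyck_interval (rowword T) i m /\
  exists2 b, f_tab i (collapse i m T) = Some b & std_tab b = T'.

Definition row_of (T : tableau) (v : nat) : nat := find (fun r => v \in r) T.

Definition descents (T : tableau) : seq nat :=
  [seq d <- iota 1 (sumn (shape T)).-1 | row_of T d < row_of T d.+1].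

Definition Des (T : tableau) : seq nat :=
  let N := sumn (shape T) in
  let D := descents T in
  if N == 0 then [::]
  else [seq p.2 - p.1 | p <- zip (0 :: D) (rcons D N)].

(* alpha^(j) for 1 <= j <= size alpha *)
Definition block (alpha : seq nat) (j : nat) : seq nat :=
  iota (sumn (take j.-1 alpha)).+1 (nth 0 alpha j.-1).

Definition block_index (alpha : seq nat) (x : nat) : nat :=
  (find (fun j => x \in block alpha j) (iota 1 (size alpha))).+1.

Definition phi (T : tableau) : tableau :=
  map (map (block_index (Des T))) T.

Definition CSvert (lam : seq nat) : pred tableau :=
  [pred T | is_SYT lam T && (size (Des T) == size lam)].

Definition Bvert (lam : seq nat) : pred tableau :=
  [pred b | is_SSYT lam (size lam) b].

(* Main.v *)
(** Replacing the entries of [T] by the indices of their blocks of [Des T] is inverted by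
    standardization: a semistandard tableau with [l] rows and entries at most [l] has first
    column [1, ..., l], so every letter occurs and the first [j.+1] of the reading word precedes
    every [j]; hence the descents of its standardization are exactly the ends of the blocks.

    Row insertion preserves the relative order of consecutive values, so a Dyck pattern interval
    [[i, i + 2m]] contains a single descent [i + m] and lies in two consecutive blocks [j], [j.+1].
    Each block appears in increasing order in the reading word, so the letters of an interval of
    values that lie in a prefix are determined by one threshold, and the bracketing rules of the
    collapsed word and of [phi T] can be compared numerically.  They select the same position [p]
    unless a letter [j.+1] outside the interval precedes [p], and in that case the edge creates an
    additional descent.  Conversely, if [f_j] acts at position [p], the interval is recovered by
    keeping the last [a] letters [j] before [p], the letters [j] from [p] on, and the first letters
    [j.+1], one fewer in number, where [a] is the number of letters [j.+1] before [p]. *)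
From mathcomp Require Import all_boot zify.
Require Import Defs.
Set Implicit Arguments. Unset Strict Implicit. Unset Printing Implicit Defensive.

(** * Counting in words and in intervals *)

Lemma count_rcons (T : Type) (P : pred T) w x : count P (rcons w x) = count P w + P x.
Proof. by rewrite -cats1 count_cat /= addn0. Qed.

Lemma take_rcons_le (T : Type) (w : seq T) x s :
  s <= size w -> take s (rcons w x) = take s w.
Proof. by move=> hs; rewrite -cats1 takel_cat. Qed.

Lemma take_rcons_gt (T : Type) (w : seq T) x s :
  size w < s -> take s (rcons w x) = rcons w x.
Proof. by move=> hs; rewrite take_oversize // size_rcons. Qed.

Lemma forall_take_rcons (T : Type) (Q : seq T -> Prop) w x :
  (forall s, Q (take s (rcons w x))) <-> (forall s, Q (take s w)) /\ Q (rcons w x).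
Proof.
split=> [Qtake|[Qtake Qall] s].
  split=> [s|]; last by have := Qtake (size w).+1; rewrite take_rcons_gt.
  by have := Qtake (minn s (size w)); rewrite take_rcons_le ?geq_minr // take_min take_size.
have [s_le|s_gt] := leqP s (size w); first by rewrite take_rcons_le.
by rewrite take_rcons_gt.
Qed.

Lemma count_take_nth (P : pred nat) w p : p <= size w ->
  count P (take p w) = count (fun q => P (nth 0 w q)) (iota 0 p).
Proof. by move=> hp; rewrite -(map_nth_iota0 0) // count_map. Qed.

Lemma count_nth (P : pred nat) w :
  count P w = count (fun q => P (nth 0 w q)) (iota 0 (size w)).
Proof. by rewrite -{1}(take_size w) count_take_nth. Qed.

Lemma count_lt (T : eqType) (P Q : pred T) s x :
  x \in s -> subpred P Q -> Q x -> ~~ P x -> count P s < count Q s.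
Proof.
move=> /perm_to_rem/permP s_rem PQ Qx nPx.
by rewrite !s_rem /= Qx (negbTE nPx) ltnS; apply: sub_count.
Qed.

Lemma count_take_split (P : pred nat) w a b : a <= b <= size w ->
  count P (take b w) = count P (take a w) + count (fun q => P (nth 0 w q)) (iota a (b - a)).
Proof.
move=> /andP[ab bw]; rewrite !count_take_nth //; last exact: leq_trans bw.
by rewrite -{1}(subnKC ab) iotaD count_cat.
Qed.

Definition itv (a b x : nat) : bool := a < x <= b.

Lemma count_le_range (P : pred nat) (s : seq nat) a b : uniq s ->
  {in s, forall x, P x -> a <= x < b} -> count P s <= b - a.
Proof.
move=> s_uniq sub; rewrite -size_filter -(size_iota a (b - a)).
apply: uniq_leq_size; first exact: filter_uniq.
by move=> x; rewrite mem_filter mem_iota => /andP[Px xs]; have := sub x xs Px; lia.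
Qed.

Lemma count_ge_range (P : pred nat) (s : seq nat) a b :
  (forall x, a <= x < b -> (x \in s) && P x) -> b - a <= count P s.
Proof.
move=> sub; rewrite -size_filter -(size_iota a (b - a)).
apply: uniq_leq_size; first exact: iota_uniq.
by move=> x; rewrite mem_iota mem_filter => hx; rewrite andbC; apply: sub; lia.
Qed.

Lemma count_eq_itv (P : pred nat) (s : seq nat) a b : uniq s ->
  (forall x, (x \in s) && P x = itv a b x) -> count P s = b - a.
Proof.
move=> s_uniq sub; rewrite -subSS; apply/eqP; rewrite eqn_leq; apply/andP; split.
  by apply: count_le_range => // x xs Px; have := sub x; rewrite xs Px /itv; lia.
by apply: count_ge_range => x hx; rewrite sub /itv; lia.
Qed.

Lemma downclosed_threshold (P : pred nat) lo hi : lo <= hi ->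
  (forall x y, lo < x -> x < y <= hi -> P y -> P x) ->
  exists2 t, lo <= t <= hi & forall x, itv lo hi x -> P x = (x <= t).
Proof.
elim: hi => [|hi IHhi] lo_le down.
  by exists lo => [|x]; rewrite ?/itv; lia.
have [->|lo_lt] := eqVneq lo hi.+1.
  by exists hi.+1 => [|x]; rewrite ?/itv; lia.
case Phi: (P hi.+1).
  exists hi.+1 => [|x]; rewrite ?/itv; first by lia.
  move=> hx; have [->|x_ne] := eqVneq x hi.+1; first by rewrite Phi; lia.
  by rewrite (down x hi.+1) //; lia.
have [|x y lo_x hxy|t ht tP] := IHhi; first by lia.
  by apply: down => //; lia.
exists t => [|x]; rewrite ?/itv; first by lia.
have [->|x_ne hx] := eqVneq x hi.+1; first by rewrite Phi; lia.
by apply: tP; rewrite /itv; lia.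
Qed.

Lemma find_iota1 n c : c < n -> find (pred1 c.+1) (iota 1 n) = c.
Proof.
move=> hc; rewrite -[find _ _]/(index c.+1 (iota 1 n)).
by rewrite -[c.+1](nth_iota 0 1 hc) index_uniq ?size_iota ?iota_uniq.
Qed.

Lemma index_iota_sub a n x : a <= x < a + n -> index x (iota a n) = x - a.
Proof.
move=> hx; have e : nth 0 (iota a n) (x - a) = x by rewrite nth_iota; lia.
by rewrite -{1}e index_uniq ?size_iota ?iota_uniq //; lia.
Qed.

Lemma rcons_iota a n : rcons (iota a n) (a + n) = iota a n.+1.
Proof. by rewrite -cats1 -[n.+1]addn1 iotaD. Qed.

Lemma rcons_iotaP (s : seq nat) x a k : rcons s x = iota a k ->
  exists2 k', k = k'.+1 & s = iota a k' /\ x = a + k'.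
Proof.
case: k => [|k]; first by case: s.
by rewrite -rcons_iota => /rcons_inj[-> ->]; exists k.
Qed.

Lemma index_filter_lt (T : eqType) (P : pred T) (s : seq T) x y : P x -> P y ->
  (index x (filter P s) < index y (filter P s)) = (index x s < index y s).
Proof.
move=> Px Py; elim: s => //= z s IHs; case Pz: (P z) => /=.
  by case: eqP => _; case: eqP => _; rewrite ?ltnS.
have [zx|_] := eqVneq z x; first by rewrite zx Px in Pz.
by have [zy|_] := eqVneq z y; first by rewrite zy Py in Pz.
Qed.

(** * Permutations of [1, ..., N] as words *)

Lemma perm_iota_of_uniq N (w : seq nat) : uniq w -> size w = N ->
  {in w, forall x, 0 < x <= N} -> perm_eq w (iota 1 N).
Proof.
move=> w_uniq size_w range; apply: uniq_perm => //; first exact: iota_uniq.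
have sub : {subset w <= iota 1 N} by move=> x /range; rewrite mem_iota; lia.
by have [] := uniq_min_size w_uniq sub; rewrite ?size_iota ?size_w.
Qed.

Definition in_order (w : seq nat) (a b : nat) : Prop :=
  forall x y, a < x -> x < y <= b -> index x w < index y w.

Lemma in_order_sub w lo hi a b :
  lo <= a -> b <= hi -> in_order w lo hi -> in_order w a b.
Proof. by move=> lo_a b_hi ordered x y hx hy; apply: ordered; lia. Qed.

Section PermWords.

Variables (N : nat) (w : seq nat).
Hypothesis w_perm : perm_eq w (iota 1 N).

Lemma mem_perm_iota x : (x \in w) = (0 < x <= N).
Proof. by rewrite (perm_mem w_perm) mem_iota; lia. Qed.

Lemma size_perm_iota : size w = N.
Proof. by rewrite (perm_size w_perm) size_iota. Qed.

Lemma uniq_perm_iota : uniq w.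
Proof. by rewrite (perm_uniq w_perm) iota_uniq. Qed.

Lemma nth_perm_iota p : p < N -> 0 < nth 0 w p <= N.
Proof. by move=> hp; rewrite -mem_perm_iota mem_nth // size_perm_iota. Qed.

Lemma index_perm_lt x : 0 < x <= N -> index x w < N.
Proof. by move=> hx; rewrite -[X in _ < X]size_perm_iota index_mem mem_perm_iota. Qed.

Lemma nth_index_perm x : 0 < x <= N -> nth 0 w (index x w) = x.
Proof. by move=> hx; rewrite nth_index // mem_perm_iota. Qed.

Lemma index_nth_perm p : p < N -> index (nth 0 w p) w = p.
Proof. by move=> hp; rewrite index_uniq ?size_perm_iota ?uniq_perm_iota. Qed.

Lemma index_perm_inj x y :
  0 < x <= N -> 0 < y <= N -> index x w = index y w -> x = y.
Proof. by move=> hx hy h; rewrite -(nth_index_perm hx) h nth_index_perm. Qed.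

Lemma mem_take_perm x s : (x \in take s w) = (0 < x <= N) && (index x w < s).
Proof.
rewrite -mem_perm_iota; have [xw|xw] := boolP (x \in w); first by rewrite in_take.
by apply: contraNF xw; apply: mem_take.
Qed.

Lemma count_itv_perm a b : b <= N -> count (itv a b) w = b - a.
Proof.
move=> bN; apply: count_eq_itv => [|x]; first exact: uniq_perm_iota.
by rewrite mem_perm_iota /itv; lia.
Qed.

(* The letters of an interval read in increasing order occur in any prefix as an initial
   segment of that interval, so counting them amounts to knowing one threshold. *)
Lemma prefix_in_order lo hi s : lo <= hi <= N -> in_order w lo hi ->
  exists t, [/\ lo <= t <= hi,
    forall x, itv lo hi x -> (index x w < s) = (x <= t) &
    forall a b, lo <= a -> b <= hi -> count (itv a b) (take s w) = minn b t - a].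
Proof.
move=> bounds ordered.
have [||t ht tP] := @downclosed_threshold (fun x => index x w < s) lo hi; first by lia.
  by move=> x y lo_x hxy; apply: ltn_trans; apply: ordered.
exists t; split=> // a b lo_a b_hi.
apply: count_eq_itv; first by rewrite take_uniq ?uniq_perm_iota.
move=> x; rewrite mem_take_perm /itv; have := tP x; rewrite /itv; lia.
Qed.

Lemma set_nth_map_perm (g : nat -> nat) p a : p < N ->
  set_nth 0 (map g w) p a = map (fun x => if x == nth 0 w p then a else g x) w.
Proof.
move=> hp; have size_w := size_perm_iota.
apply: (@eq_from_nth _ 0); rewrite size_set_nth !size_map size_w ?(maxn_idPr hp) // => q hq.
rewrite nth_set_nth /= !(nth_map 0) ?size_w //.
by rewrite nth_uniq ?size_w ?uniq_perm_iota.
Qed.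

Lemma filter_perm_iota (P : pred nat) a n :
  0 < a -> a + n <= N.+1 ->
  (forall x, 0 < x <= N -> P x = (a <= x < a + n)) ->
  in_order w a.-1 (a + n).-1 -> filter P w = iota a n.
Proof.
move=> a_gt0 anN PE ordered; have w_uniq := uniq_perm_iota.
have memP x : (x \in filter P w) = (a <= x < a + n).
  by rewrite mem_filter mem_perm_iota; have := PE x; case: (P x); lia.
have letter_range r : r < size (filter P w) -> a <= nth 0 (filter P w) r < a + n.
  by move=> hr; rewrite -memP mem_nth.
apply: (irr_sorted_eq ltn_trans ltnn).
- apply/(sortedP 0) => q hq; rewrite ltn_neqAle.
  rewrite nth_uniq ?filter_uniq ?(ltnW hq) //; apply/andP; split; first by lia.
  rewrite leqNgt; apply/negP => descent.
  have hx := letter_range _ (ltnW hq); have hy := letter_range _ hq.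
  have : index (nth 0 (filter P w) q.+1) w < index (nth 0 (filter P w) q) w.
    by apply: ordered; lia.
  rewrite -(@index_filter_lt _ P) ?PE; [|lia..].
  by rewrite !index_uniq ?filter_uniq ?(ltnW hq) //; lia.
- exact: iota_ltn_sorted.
- by move=> x; rewrite memP mem_iota.
Qed.

End PermWords.

(** * Standardization *)

(* The order in which standardization numbers the positions of [v]. *)
Definition std_le (v : seq nat) (q p : nat) : bool :=
  (nth 0 v q < nth 0 v p) || (nth 0 v q == nth 0 v p) && (q <= p).

Lemma std_le_trans v : transitive (std_le v).
Proof. by move=> b a c; rewrite /std_le; lia. Qed.

Lemma size_std_word v : size (std_word v) = size v.
Proof. by rewrite size_map size_iota. Qed.

Lemma nth_std_word v p : p < size v ->
  nth 0 (std_word v) p = count (std_le v ^~ p) (iota 0 (size v)).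
Proof.
move=> hp; rewrite (nth_map 0) ?size_iota // nth_iota // add0n.
rewrite count_nth count_take_nth //.
have -> : count (fun q => pred1 (nth 0 v p) (nth 0 v q)) (iota 0 p.+1)
        = count (fun q => (nth 0 v q == nth 0 v p) && (q <= p)) (iota 0 (size v)).
  rewrite -(subnKC hp) iotaD count_cat [X in _ = _ + X](@eq_in_count _ _ pred0).
    rewrite count_pred0 addn0; apply: eq_in_count => q; rewrite mem_iota /= => hq.
    by rewrite (_ : q <= p) ?andbT; lia.
  by move=> q; rewrite mem_iota /=; lia.
rewrite -count_predUI [X in _ + X](@eq_count _ _ pred0) ?count_pred0 ?addn0 //.
by move=> q /=; lia.
Qed.

Lemma std_word_le v p q : p < size v -> q < size v ->
  (nth 0 (std_word v) q <= nth 0 (std_word v) p) = std_le v q p.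
Proof.
move=> hp hq; rewrite !nth_std_word //.
have [le_qp|nle_qp] := boolP (std_le v q p).
  by apply: sub_count => r /= /std_le_trans; apply.
apply/negbTE; rewrite -ltnNge; apply: (@count_lt _ _ _ _ q) => //.
- by rewrite mem_iota; lia.
- by move=> r /= /std_le_trans; apply; move: nle_qp; rewrite /std_le; lia.
- by rewrite /= /std_le; lia.
Qed.

Lemma std_word_perm v : perm_eq (std_word v) (iota 1 (size v)).
Proof.
apply: perm_iota_of_uniq; rewrite ?size_std_word //.
  apply/(uniqP 0) => p q; rewrite !inE size_std_word => hp hq epq.
  have := std_word_le hp hq; have := std_word_le hq hp.
  by rewrite epq leqnn /std_le; lia.
move=> x /(nthP 0)[p]; rewrite size_std_word => hp <-; rewrite nth_std_word //.
have := count_size (std_le v ^~ p) (iota 0 (size v)); rewrite size_iota => ->.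
rewrite -has_count andbT.
by apply/hasP; exists p; rewrite ?mem_iota /std_le; lia.
Qed.

Lemma eq_std_word v v' : size v = size v' ->
  (forall p q, p < size v -> q < size v -> std_le v q p = std_le v' q p) ->
  std_word v = std_word v'.
Proof.
move=> eq_size eq_le; apply: (@eq_from_nth _ 0); rewrite !size_std_word // => p hp.
rewrite !nth_std_word -?eq_size //; apply: eq_in_count => q.
by rewrite mem_iota => hq; apply: eq_le; lia.
Qed.

Section StdPerm.

Variables (N : nat) (w : seq nat).
Hypothesis w_perm : perm_eq w (iota 1 N).

Lemma eq_std_word_map (g h : nat -> nat) :
  (forall x y, 0 < x -> x < y <= N ->
     (g x < g y) || (g x == g y) && (index x w < index y w)
     = (h x < h y) || (h x == h y) && (index x w < index y w)) ->
  std_word (map g w) = std_word (map h w).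
Proof.
have size_w := size_perm_iota w_perm.
move=> eq_order; apply: eq_std_word; rewrite !size_map // size_w => p q hp hq.
have [->|qp] := eqVneq q p; first by rewrite /std_le !eqxx !leqnn !orbT.
rewrite /std_le !(nth_map 0) ?size_w // [q <= p]leq_eqVlt (negbTE qp) /=.
have := nth_perm_iota w_perm hp; have := nth_perm_iota w_perm hq.
have := index_nth_perm w_perm hp; have := index_nth_perm w_perm hq.
set x := nth 0 w p; set y := nth 0 w q => iy ix hy hx.
have [xy|yx|xy] := ltngtP x y; last by rewrite xy iy in ix; rewrite ix eqxx in qp.
  by have := eq_order x y; rewrite ix iy; lia.
by have := eq_order y x; rewrite ix iy; lia.
Qed.

Lemma std_word_id : std_word w = w.
Proof.
have size_w := size_perm_iota w_perm; have w_uniq := uniq_perm_iota w_perm.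
apply: (@eq_from_nth _ 0); rewrite size_std_word // size_w => p hp.
have xN := nth_perm_iota w_perm hp; set x := nth 0 w p in xN *.
have -> : nth 0 (std_word w) p = count (gtn x) w + count_mem x (take p.+1 w).
  by rewrite (nth_map 0) ?size_iota ?size_w // nth_iota ?size_w.
rewrite (@count_eq_itv _ _ 0 x.-1) // => [|y]; last first.
  by rewrite (mem_perm_iota w_perm) /itv /=; lia.
rewrite count_uniq_mem ?take_uniq // (mem_take_perm w_perm) xN.
by rewrite (index_nth_perm w_perm hp); lia.
Qed.

Lemma std_word_map (g : nat -> nat) :
  (forall x y, 0 < x -> x < y <= N -> g x <= g y) ->
  (forall x y, 0 < x -> x < y <= N -> g x = g y -> index x w < index y w) ->
  std_word (map g w) = w.
Proof.
move=> g_mono g_ordered; rewrite -[RHS]std_word_id -[in RHS](map_id w).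
by apply: eq_std_word_map => x y x0 xy; have := g_mono x y; have := g_ordered x y; lia.
Qed.

End StdPerm.

(** * Inverse descents and blocks *)

Definition idescent (w : seq nat) (d : nat) : bool := index d.+1 w < index d w.

(* When [w] is the reading word of a standard tableau [T], this is the index of the block of
   [Des T] containing [x]; see [mem_block] below. *)
Definition iblock (w : seq nat) (x : nat) : nat := (count (idescent w) (iota 1 x.-1)).+1.

Lemma iblockS w x : 0 < x -> iblock w x.+1 = iblock w x + idescent w x.
Proof.
by case: x => // x _; rewrite /iblock !succnK -rcons_iota -cats1 count_cat /= addn0 addSn.
Qed.

Lemma iblock_homo w x y : 0 < x -> x <= y -> iblock w x <= iblock w y.
Proof.
move=> x0 xy; rewrite -(subnK xy); elim: (y - x) => // k IHk.
by rewrite addSn iblockS; lia.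
Qed.

Lemma eq_iblock_increment w w' x y : 0 < x -> x <= y ->
  (forall d, x <= d < y -> idescent w d = idescent w' d) ->
  iblock w y + iblock w' x = iblock w' y + iblock w x.
Proof.
move=> x0 xy; rewrite -(subnK xy); elim: (y - x) => [|k IHk] eq_desc.
  by rewrite add0n addnC.
have {}IHk : iblock w (k + x) + iblock w' x = iblock w' (k + x) + iblock w x.
  by apply: IHk => d hd; apply: eq_desc; lia.
by rewrite addSn !iblockS ?eq_desc; lia.
Qed.

Lemma iblock_eq_index_le w x y :
  0 < x <= y -> iblock w x = iblock w y -> index x w <= index y w.
Proof.
case/andP=> x0 xy; rewrite -(subnK xy); elim: (y - x) => // k IHk.
have := iblock_homo w x0 (leq_addl k x); rewrite addSn iblockS; last by lia.
case descent: (idescent w (k + x)); first by lia.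
rewrite addn0 => _ /IHk le_x; apply: leq_trans le_x _.
by move: descent; rewrite /idescent; lia.
Qed.

Section BlocksOfPerm.

Variables (N : nat) (w : seq nat).
Hypothesis w_perm : perm_eq w (iota 1 N).

Lemma iblock_eq_index x y :
  0 < x -> x < y <= N -> iblock w x = iblock w y -> index x w < index y w.
Proof.
move=> x0 xy eq_block; rewrite ltn_neqAle iblock_eq_index_le // ?andbT; last by lia.
by apply/eqP => /(index_perm_inj w_perm); lia.
Qed.

Lemma std_map_iblock : std_word (map (iblock w) w) = w.
Proof.
apply: (std_word_map w_perm) => [x y x0 xy|]; last exact: iblock_eq_index.
by apply: iblock_homo => //; lia.
Qed.

Definition block_end (j : nat) : nat := count (fun x => iblock w x <= j) (iota 1 N).

Lemma block_end_le j : block_end j <= N.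
Proof. by rewrite -[X in _ <= X](size_iota 1); apply: count_size. Qed.

Lemma iblock_le j x : 0 < x <= N -> (iblock w x <= j) = (x <= block_end j).
Proof.
have [||t ht tP] := @downclosed_threshold (fun x => iblock w x <= j) 0 N; first by lia.
  by move=> y z y0 yz; apply: leq_trans; apply: iblock_homo; lia.
move=> hx; rewrite tP //; congr (x <= _); apply/esym.
rewrite /block_end (@count_eq_itv _ _ 0 t) ?iota_uniq ?subn0 // => y.
by rewrite mem_iota; have := tP y; rewrite /itv; case: (_ <= j) => /=; lia.
Qed.

Lemma iblock_eq j x : 0 < j -> 0 < x <= N ->
  (iblock w x == j) = itv (block_end j.-1) (block_end j) x.
Proof.
by move=> j0 hx; have := iblock_le j.-1 hx; have := iblock_le j hx; rewrite /itv; lia.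
Qed.

Lemma block_end_homo j : block_end j.-1 <= block_end j.
Proof. by apply: sub_count => x /leq_trans; apply; apply: leq_pred. Qed.

Lemma block_in_order j : 0 < j -> in_order w (block_end j.-1) (block_end j).
Proof.
move=> j0 x y hx hy; have := block_end_le j => end_le.
apply: iblock_eq_index; try lia.
by have := @iblock_eq j x j0; have := @iblock_eq j y j0; rewrite /itv; lia.
Qed.

End BlocksOfPerm.

(** * Reading words of tableaux *)

Lemma rowword_map (g : nat -> nat) t : rowword (map (map g) t) = map g (rowword t).
Proof. by rewrite /rowword -map_rev map_flatten. Qed.

Lemma shape_map (g : nat -> nat) t : shape (map (map g) t) = shape t.
Proof. by rewrite /shape -map_comp; apply: eq_map => r /=; rewrite size_map. Qed.

Lemma size_rowword t : size (rowword t) = sumn (shape t).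
Proof. by rewrite /rowword size_flatten /seq.shape map_rev sumn_rev. Qed.

Lemma rowwordK t : tab_of_word (shape t) (rowword t) = t.
Proof. by rewrite /tab_of_word /rowword /shape -map_rev flattenK revK. Qed.

Lemma tab_of_wordK sh w : size w = sumn sh -> rowword (tab_of_word sh w) = w.
Proof. by move=> size_w; rewrite /rowword revK reshapeKr // sumn_rev size_w. Qed.

Lemma shape_tab_of_word sh w : size w = sumn sh -> shape (tab_of_word sh w) = sh.
Proof.
move=> size_w; rewrite /shape /tab_of_word map_rev.
by rewrite -[map size _]/(seq.shape _) reshapeKl ?revK // sumn_rev size_w.
Qed.

Lemma rowword_cat t1 t2 : rowword (t1 ++ t2) = rowword t2 ++ rowword t1.
Proof. by rewrite /rowword rev_cat flatten_cat. Qed.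

Lemma rowword_cons r t : rowword (r :: t) = rowword t ++ r.
Proof. by rewrite /rowword rev_cons flatten_rcons. Qed.

Lemma perm_rowword t : perm_eq (flatten t) (rowword t).
Proof. by elim: t => //= r t IHt; rewrite rowword_cons perm_catC perm_cat2r. Qed.

(* The rows above row [r] come first in the reading word. *)
Definition cell_pos (sh : seq nat) (r c : nat) : nat := sumn (drop r.+1 sh) + c.

Lemma cell_posE sh r c : cell_pos sh r c = cell_pos sh r 0 + c.
Proof. by rewrite /cell_pos addn0. Qed.

Lemma nth_shape t r : nth 0 (shape t) r = size (nth [::] t r).
Proof.
have [hr|hr] := ltnP r (size t); first by rewrite (nth_map [::]).
by rewrite !nth_default ?size_map.
Qed.

Lemma lt_size_of_nth (sh : seq nat) r c : c < nth 0 sh r -> r < size sh.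
Proof. by move=> hc; rewrite ltnNge; apply/negP => hr; rewrite nth_default in hc. Qed.

Lemma nth_rowword t r c : c < nth 0 (shape t) r ->
  nth 0 (rowword t) (cell_pos (shape t) r c) = nth 0 (nth [::] t r) c.
Proof.
move=> hc; have hr := lt_size_of_nth hc; rewrite size_map in hr.
rewrite nth_shape in hc.
rewrite -{1}(cat_take_drop r t) (drop_nth [::] hr) rowword_cat rowword_cons.
rewrite -catA nth_cat /cell_pos size_rowword /shape map_drop.
by rewrite ltnNge leq_addr /= addKn nth_cat hc.
Qed.

Lemma cell_posP sh p : p < sumn sh ->
  exists r c, c < nth 0 sh r /\ p = cell_pos sh r c.
Proof.
elim: sh => //= a sh IHsh hp; have [lt_p|le_p] := ltnP p (sumn sh).
  by have [r [c [hc ->]]] := IHsh lt_p; exists r.+1, c.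
by exists 0, (p - sumn sh); rewrite /cell_pos /= drop0; lia.
Qed.

Lemma nth_add_sumn_drop sh r r' : r < r' ->
  nth 0 sh r' + sumn (drop r'.+1 sh) <= sumn (drop r.+1 sh).
Proof.
elim: sh r r' => [|a sh IHsh] r [|r'] // hr.
case: r hr => [_|r hr] /=; last exact: IHsh.
rewrite drop0; have [hs|hs] := ltnP r' (size sh).
  by rewrite -{3}(cat_take_drop r' sh) sumn_cat (drop_nth 0 hs) /=; lia.
by rewrite nth_default // drop_oversize //; lia.
Qed.

Lemma cell_pos_lt sh r r' c c' : r < r' -> c' < nth 0 sh r' ->
  cell_pos sh r' c' < cell_pos sh r c.
Proof. by move=> /(nth_add_sumn_drop sh); rewrite /cell_pos; lia. Qed.

Lemma cell_pos_bound sh r c : c < nth 0 sh r -> cell_pos sh r c < sumn sh.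
Proof.
case: sh => [|a sh]; first by rewrite nth_nil.
case: r => [|r] hc; first by rewrite /cell_pos /= drop0 /= in hc *; lia.
by have := cell_pos_lt 0 (ltn0Sn r) hc; rewrite {2}/cell_pos /= drop0; lia.
Qed.

Lemma partition_nth lam r : is_partition lam -> nth 0 lam r.+1 <= nth 0 lam r.
Proof.
case/andP=> lam_sorted _; have [hr|hr] := ltnP r.+1 (size lam); last by rewrite nth_default.
have geq_trans : transitive geq by move=> a b c /= h1 h2; lia.
by apply: (sorted_leq_nth geq_trans (fun a => leqnn a) 0 lam_sorted); rewrite ?inE; lia.
Qed.

Lemma partition_nth_gt0 lam r : is_partition lam -> r < size lam -> 0 < nth 0 lam r.
Proof. by case/andP=> _ /allP pos hr; apply/pos/mem_nth. Qed.

Lemma sumn_partition_gt0 lam : is_partition lam -> 0 < size lam -> 0 < sumn lam.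
Proof.
move=> lam_part lam_gt0; have := partition_nth_gt0 lam_part lam_gt0.
by case: lam {lam_part} lam_gt0 => //= a s _; lia.
Qed.

Definition ssyt_word (sh w : seq nat) : Prop :=
  (forall r c, c.+1 < nth 0 sh r ->
     nth 0 w (cell_pos sh r c) <= nth 0 w (cell_pos sh r c.+1)) /\
  (forall r c, c < nth 0 sh r.+1 ->
     nth 0 w (cell_pos sh r c) < nth 0 w (cell_pos sh r.+1 c)).

Lemma is_ssytP t : is_partition (shape t) ->
  is_ssyt t <-> ssyt_word (shape t) (rowword t).
Proof.
move=> t_part; have below r c : c < nth 0 (shape t) r.+1 -> c < nth 0 (shape t) r.
  by move=> hc; apply: leq_trans hc (partition_nth _ t_part).
have row_lt r c : c < nth 0 (shape t) r -> r < size t.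
  by move=> /lt_size_of_nth; rewrite size_map.
split=> [/andP[/allP rows /allP cols]|[rows cols]].
  split=> r c hc.
    rewrite !nth_rowword //; last exact: ltnW.
    have /(sorted_ltn_nth leq_trans 0) := rows _ (mem_nth [::] (row_lt _ _ hc)).
    by apply; rewrite ?inE -?nth_shape //; apply: ltnW.
  rewrite !nth_rowword //; last exact: below.
  have /allP : all (fun c => nth 0 (nth [::] t r) c < nth 0 (nth [::] t r.+1) c)
                   (iota 0 (size (nth [::] t r.+1))).
    by apply: cols; rewrite mem_iota (row_lt _ _ (below _ _ hc)).
  by apply; rewrite mem_iota -nth_shape.
apply/andP; split; apply/allP.
  move=> R /(nthP [::])[r hr <-]; apply/(sortedP 0) => c; rewrite -nth_shape => hc.
  by rewrite -!nth_rowword ?(ltnW hc) // rows.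
move=> r _; apply/allP => c; rewrite mem_iota -nth_shape => hc.
by rewrite -!nth_rowword; [apply: cols|exact: hc|apply: below].
Qed.

Lemma ssyt_word_row sh w r c c' : ssyt_word sh w -> c <= c' -> c' < nth 0 sh r ->
  nth 0 w (cell_pos sh r c) <= nth 0 w (cell_pos sh r c').
Proof.
move=> [rows _] /subnK <-; elim: (c' - c) => // k IHk hk.
by apply: leq_trans (IHk _) (rows _ _ _); rewrite ?addSn in hk *; lia.
Qed.

(** * Descent compositions of standard tableaux *)

Definition gaps (N s : nat) (D : seq nat) : seq nat :=
  [seq p.2 - p.1 | p <- zip (s :: D) (rcons D N)].

Lemma size_gaps N s D : size (gaps N s D) = (size D).+1.
Proof. by rewrite size_map size_zip /= size_rcons minnn. Qed.

Lemma mem_gap N s D x k : path ltn s (rcons D N) -> s < x <= N ->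
  (x - s \in iota (sumn (take k (gaps N s D))).+1 (nth 0 (gaps N s D) k))
    = (count (gtn x) D == k).
Proof.
elim: D s k => [|d D IHD] s k /= D_path hx.
  case: k => [|k] /=; rewrite mem_iota /=; first by lia.
  by rewrite nth_nil; lia.
case/andP: D_path => sd D_path.
have count0 : x <= d -> count (gtn x) D = 0.
  move=> xd; apply/eqP; rewrite eqn0Ngt -has_count; apply/hasP => -[e eD /=].
  have /allP/(_ e) := order_path_min ltn_trans D_path.
  by rewrite mem_rcons inE eD orbT => /(_ isT) /=; lia.
case: k => [|k] /=; rewrite mem_iota /=.
  by have [xd|xd] := leqP x d; first rewrite count0 //; lia.
have [xd|xd] := leqP x d; first by rewrite count0 // add0n; lia.
rewrite -/(gaps N d D) -[RHS]/(count _ D == k) -(IHD d) // ?mem_iota; last by lia.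
by set a := sumn _; set b := nth 0 _ _; lia.
Qed.

Section Descents.

Variables (lam : seq nat) (T : tableau).
Hypotheses (lam_part : is_partition lam) (T_syt : is_SYT lam T).
Let N := sumn lam.
Let w := rowword T.

Lemma syt_shape : shape T = lam.
Proof. by case/and3P: T_syt => /eqP. Qed.

Lemma syt_word : ssyt_word lam w.
Proof. by case/and3P: T_syt => /eqP <- T_ssyt _; apply/is_ssytP; rewrite ?syt_shape. Qed.

Lemma syt_perm : perm_eq w (iota 1 N).
Proof. by case/and3P: T_syt => _ _; apply: perm_trans; rewrite perm_sym perm_rowword. Qed.

Lemma row_of_cell r c : c < nth 0 lam r -> row_of T (nth 0 w (cell_pos lam r c)) = r.
Proof.
have entryE r' c' : c' < nth 0 lam r' ->
    nth 0 w (cell_pos lam r' c') = nth 0 (nth [::] T r') c'.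
  by move=> hc'; rewrite /w -syt_shape nth_rowword // syt_shape.
move=> hc; set x := nth 0 w _; have size_T : size T = size lam by rewrite -syt_shape size_map.
have x_row : x \in nth [::] T r by rewrite /x entryE // mem_nth // -nth_shape syt_shape.
have row_le : row_of T x <= r.
  by rewrite leqNgt; apply/negP => /(before_find [::]); rewrite x_row.
apply/eqP; rewrite eqn_leq row_le leqNgt; apply/negP => row_lt.
have : x \in nth [::] T (row_of T x).
  apply: (@nth_find _ [::] (fun R => x \in R)); apply/hasP; exists (nth [::] T r) => //.
  by rewrite mem_nth // size_T (lt_size_of_nth hc).
move/(nthP 0)=> [c']; rewrite -nth_shape syt_shape => hc'; rewrite -entryE // => xE.
have := cell_pos_lt c' row_lt hc; have := index_nth_perm syt_perm (cell_pos_bound hc').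
by rewrite xE (index_nth_perm syt_perm (cell_pos_bound hc)); lia.
Qed.

Lemma row_of_idescent d : 0 < d < N -> (row_of T d < row_of T d.+1) = idescent w d.
Proof.
move=> hd; have cellP x : 0 < x <= N -> exists r c,
    [/\ c < nth 0 lam r, row_of T x = r & index x w = cell_pos lam r c].
  move=> hx; have [r [c [hc index_x]]] := cell_posP (index_perm_lt syt_perm hx).
  by exists r, c; split; rewrite // -(row_of_cell hc) -index_x (nth_index_perm syt_perm).
have [|r [c [hc row_d index_d]]] := cellP d; first by lia.
have [|r' [c' [hc' row_d1 index_d1]]] := cellP d.+1; first by lia.
rewrite row_d row_d1 /idescent index_d index_d1; have [rr'|rr'|rr'] := ltngtP r r'.
- by rewrite (cell_pos_lt c rr' hc').
- by have := cell_pos_lt c' rr' hc; lia.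
- rewrite -rr' /cell_pos ltn_add2l; apply/esym/negbTE/negP => c'c.
  have := ssyt_word_row syt_word (ltnW c'c) hc.
  by rewrite {1}rr' -index_d -index_d1 !(nth_index_perm syt_perm); lia.
Qed.

Lemma descentsE : descents T = filter (idescent w) (iota 1 N.-1).
Proof.
rewrite /descents syt_shape; apply: eq_in_filter => d; rewrite mem_iota => hd.
by apply: row_of_idescent; rewrite -/N in hd; lia.
Qed.

Lemma count_descents x : 0 < x <= N -> (count (gtn x) (descents T)).+1 = iblock w x.
Proof.
move=> hx; rewrite descentsE /iblock count_filter; congr _.+1.
have -> : N.-1 = x.-1 + (N - x) by lia.
rewrite iotaD count_cat [X in _ + X](@eq_in_count _ _ pred0) => [|d]; last first.
  by rewrite mem_iota /=; lia.
rewrite count_pred0 addn0; apply: eq_in_count => d; rewrite mem_iota /= => hd.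
by rewrite (_ : d < x) //; lia.
Qed.

Hypothesis N_gt0 : 0 < N.

Lemma DesE : Des T = gaps N 0 (descents T).
Proof. by rewrite /Des syt_shape -/N eqn0Ngt N_gt0. Qed.

Lemma size_Des : size (Des T) = iblock w N.
Proof.
rewrite DesE size_gaps -count_descents ?N_gt0 ?leqnn //; congr _.+1.
apply/esym/eqP; rewrite -all_count; apply/allP => d.
by rewrite descentsE mem_filter mem_iota /=; lia.
Qed.

Lemma mem_block x j : 0 < j -> 0 < x <= N -> (x \in block (Des T) j) = (iblock w x == j).
Proof.
case: j => // j _ hx; rewrite -count_descents // eqSS /block DesE /=.
rewrite -[in LHS](subn0 x) mem_gap //.
have : sorted ltn (descents T).
  by rewrite descentsE sorted_filter ?iota_ltn_sorted //; apply: ltn_trans.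
have : {in descents T, forall d, 0 < d < N}.
  by move=> d; rewrite descentsE mem_filter mem_iota; lia.
case: (descents T) => [|d D] range /= D_sorted; first by rewrite N_gt0.
rewrite rcons_path D_sorted /=; have := range d (mem_head _ _).
by have := range (last d D) (mem_last _ _); lia.
Qed.

Lemma block_indexE x : 0 < x <= N -> block_index (Des T) x = iblock w x.
Proof.
move=> hx; rewrite /block_index.
rewrite (@eq_in_find _ _ (pred1 (iblock w x))) => [|j]; last first.
  by rewrite mem_iota => hj /=; rewrite mem_block 1?eq_sym //; lia.
rewrite find_iota1 // size_Des.
by case/andP: hx; apply: iblock_homo.
Qed.

Lemma rowword_phi : rowword (phi T) = map (iblock w) w.
Proof.
rewrite /phi rowword_map; apply/eq_in_map => x.
by rewrite (mem_perm_iota syt_perm) => /block_indexE.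
Qed.

Lemma shape_phi : shape (phi T) = lam.
Proof. by rewrite shape_map syt_shape. Qed.

End Descents.

(** * Standardization inverts the map on vertices *)

Definition crystal_word (lam v : seq nat) : Prop :=
  [/\ size v = sumn lam, ssyt_word lam v
    & forall p, p < sumn lam -> 0 < nth 0 v p <= size lam].

Lemma crystal_word_iblock lam w : is_partition lam -> perm_eq w (iota 1 (sumn lam)) ->
  ssyt_word lam w -> iblock w (sumn lam) = size lam -> crystal_word lam (map (iblock w) w).
Proof.
move=> lam_part w_perm [rows cols] last_block; have size_w := size_perm_iota w_perm.
split; first by rewrite size_map.
  split=> r c hc.
    have pos_lt := cell_pos_bound hc; have pos_lt' := cell_pos_bound (ltnW hc).
    rewrite !(nth_map 0) ?size_w //; apply: iblock_homo; last exact: rows.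
    by case/andP: (nth_perm_iota w_perm pos_lt').
  have pos_lt := cell_pos_bound hc.
  have pos_lt' := cell_pos_bound (leq_trans hc (partition_nth r lam_part)).
  rewrite !(nth_map 0) ?size_w //; have up := cols _ _ hc.
  have hx := nth_perm_iota w_perm pos_lt; have hy := nth_perm_iota w_perm pos_lt'.
  rewrite ltn_neqAle iblock_homo ?andbT; [|lia..].
  apply/eqP => /(iblock_eq_index_le _); rewrite !(index_nth_perm w_perm) // => le_pos.
  by have := cell_pos_lt c (ltnSn r) hc; rewrite ltnNge le_pos //; lia.
move=> p hp; rewrite (nth_map 0) ?size_w //= -last_block.
by case/andP: (nth_perm_iota w_perm hp); apply: iblock_homo.
Qed.

Section CrystalWord.

Variables (lam v : seq nat).
Hypotheses (lam_part : is_partition lam) (v_crystal : crystal_word lam v).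
Let N := sumn lam.

Lemma first_column_bound r : r < size lam -> cell_pos lam r 0 < N.
Proof. by move=> hr; apply: cell_pos_bound; apply: partition_nth_gt0. Qed.

(* With [size lam] rows and as many letters, a strictly increasing first column is forced. *)
Lemma first_column r : r < size lam -> nth 0 v (cell_pos lam r 0) = r.+1.
Proof.
have [_ [_ cols] range] := v_crystal.
have step s : s.+1 < size lam ->
    nth 0 v (cell_pos lam s 0) < nth 0 v (cell_pos lam s.+1 0).
  by move=> hs; apply: cols; apply: partition_nth_gt0.
have lower s : s < size lam -> s < nth 0 v (cell_pos lam s 0).
  elim: s => [|s IHs] hs; first by have := range _ (first_column_bound hs); lia.
  by apply: leq_ltn_trans (step _ hs); apply: IHs; lia.
have upper k s : s + k.+1 = size lam -> nth 0 v (cell_pos lam s 0) <= s.+1.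
  elim: k s => [|k IHk] s hs; last by have := IHk s.+1; have := step s; lia.
  by have := range _ (@first_column_bound s _); lia.
by move=> hr; have := lower r hr; have := upper (size lam - r.+1) r; lia.
Qed.

Lemma first_column_before j q : j < size lam -> q < N ->
  nth 0 v q = j -> cell_pos lam j 0 < q.
Proof.
have [_ v_ssyt _] := v_crystal.
move=> hj /cell_posP[r [c [hc ->]]] letter_j.
have [rj|jr] := ltnP r j; first by apply: cell_pos_lt => //; apply: partition_nth_gt0.
have := ssyt_word_row v_ssyt (leq0n c) hc.
by rewrite first_column ?(lt_size_of_nth hc) //; lia.
Qed.

Let w := std_word v.

Lemma crystal_std_perm : perm_eq w (iota 1 N).
Proof. by have [size_v _ _] := v_crystal; rewrite /N -size_v; apply: std_word_perm. Qed.

Lemma ssyt_word_std : ssyt_word lam w.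
Proof.
have [size_v [rows cols] _] := v_crystal; split=> r c hc.
  have pos_lt := cell_pos_bound hc; have pos_lt' := cell_pos_bound (ltnW hc).
  by rewrite std_word_le ?size_v // /std_le; have := rows r c hc; rewrite /cell_pos; lia.
have pos_lt := cell_pos_bound hc.
have pos_lt' := cell_pos_bound (leq_trans hc (partition_nth r lam_part)).
by rewrite ltnNge std_word_le ?size_v // /std_le; have := cols r c hc; lia.
Qed.

Lemma std_le_index x y : 0 < x <= N -> 0 < y <= N ->
  std_le v (index x w) (index y w) = (x <= y).
Proof.
have [size_v _ _] := v_crystal; have w_perm := crystal_std_perm.
move=> hx hy; rewrite -std_word_le ?size_v ?(index_perm_lt w_perm) //.
by rewrite !(nth_index_perm w_perm).
Qed.

Lemma first_column_letter r : r < size lam ->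
  exists2 y, 0 < y <= N & index y w = cell_pos lam r 0.
Proof.
move=> /first_column_bound pos_lt; have w_perm := crystal_std_perm.
by exists (nth 0 w (cell_pos lam r 0)); rewrite ?(nth_perm_iota w_perm) ?(index_nth_perm w_perm).
Qed.

Lemma iblock_std x : 0 < x <= N -> iblock w x = nth 0 v (index x w).
Proof.
have [_ _ range] := v_crystal; have w_perm := crystal_std_perm.
elim: x => // x IHx x1N; have := range _ (index_perm_lt w_perm x1N).
have [x0|x_gt0] := posnP x.
  rewrite {x IHx}x0 in x1N * => range1; have lam_gt0 : 0 < size lam by lia.
  have [y yN index_y] := first_column_letter lam_gt0.
  by have := std_le_index x1N yN; rewrite index_y /std_le first_column // /iblock /=; lia.
have xN : 0 < x <= N by lia.
rewrite iblockS // IHx // /idescent => range_x1.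
have range_x := range _ (index_perm_lt w_perm xN).
have := std_le_index xN x1N; have := std_le_index x1N xN; rewrite /std_le.
have [up _ _| |] := ltngtP (nth 0 v (index x w)) (nth 0 v (index x.+1 w)); [|lia|lia].
have hr : nth 0 v (index x w) < size lam by lia.
have := first_column_before hr (index_perm_lt w_perm xN) erefl.
have [y yN index_y] := first_column_letter hr.
have := std_le_index yN xN; have := std_le_index x1N yN.
by rewrite index_y /std_le first_column //; lia.
Qed.

Lemma iblock_std_last : 0 < size lam -> iblock w N = size lam.
Proof.
move=> lam_gt0; have [_ _ range] := v_crystal.
have N_gt0 := sumn_partition_gt0 lam_part lam_gt0; rewrite -/N in N_gt0.
have NN : 0 < N <= N by lia.
have last_row : (size lam).-1 < size lam by lia.
rewrite iblock_std //; have := range _ (index_perm_lt crystal_std_perm NN).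
have [y yN index_y] := first_column_letter last_row.
by have := std_le_index yN NN; rewrite index_y /std_le first_column //; lia.
Qed.

Lemma map_iblock_std : map (iblock w) w = v.
Proof.
have [size_v _ _] := v_crystal; have w_perm := crystal_std_perm.
apply: (@eq_from_nth _ 0); rewrite size_map size_std_word // size_v => p hp.
rewrite (nth_map 0) ?size_std_word ?size_v //.
by rewrite iblock_std ?(nth_perm_iota w_perm) // (index_nth_perm w_perm).
Qed.

End CrystalWord.

Section Vertices.

Variable lam : seq nat.
Hypotheses (lam_part : is_partition lam) (lam_gt0 : 0 < size lam).
Let N_gt0 : 0 < sumn lam := sumn_partition_gt0 lam_part lam_gt0.

Lemma CSvertP T :
  reflect (is_SYT lam T /\ iblock (rowword T) (sumn lam) = size lam) (T \in CSvert lam).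
Proof.
rewrite inE /=; apply: (iffP andP) => -[T_syt]; rewrite (size_Des lam_part T_syt N_gt0).
  by move/eqP.
by move->.
Qed.

Lemma BvertP b : b \in Bvert lam <-> shape b = lam /\ crystal_word lam (rowword b).
Proof.
rewrite inE /= /is_SSYT (perm_all _ (perm_rowword b)); split.
  case/and3P=> /eqP shape_b b_ssyt /(all_nthP 0) range; split=> //; split.
  - by rewrite size_rowword shape_b.
  - by rewrite -[in ssyt_word lam]shape_b; apply/is_ssytP; rewrite ?shape_b.
  - by move=> p hp; apply: range; rewrite size_rowword shape_b.
case=> shape_b [_ b_ssyt range]; apply/and3P; split; first exact/eqP.
  by apply/is_ssytP; rewrite shape_b.
by apply/(all_nthP 0) => p; rewrite size_rowword shape_b => /range.
Qed.

Lemma tab_of_word_Bvert v : crystal_word lam v -> tab_of_word lam v \in Bvert lam.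
Proof.
by move=> v_crystal; have [size_v _ _] := v_crystal; apply/BvertP;
  rewrite tab_of_wordK // shape_tab_of_word.
Qed.

Lemma phi_Bvert T : T \in CSvert lam -> phi T \in Bvert lam.
Proof.
case/CSvertP=> T_syt last_block; apply/BvertP.
rewrite (shape_phi T_syt) (rowword_phi lam_part T_syt N_gt0); split=> //.
by apply: crystal_word_iblock => //; [apply: syt_perm | apply: syt_word].
Qed.

Lemma phiK : {in CSvert lam, cancel phi std_tab}.
Proof.
move=> T /CSvertP[T_syt _]; rewrite /std_tab (shape_phi T_syt).
rewrite (rowword_phi lam_part T_syt N_gt0) (std_map_iblock (syt_perm T_syt)).
by rewrite -(syt_shape T_syt) rowwordK.
Qed.

Lemma rowword_std_tab b : rowword (std_tab b) = std_word (rowword b).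
Proof. by rewrite /std_tab tab_of_wordK // size_std_word size_rowword. Qed.

Lemma shape_std_tab b : shape (std_tab b) = shape b.
Proof. by rewrite /std_tab shape_tab_of_word // size_std_word size_rowword. Qed.

Lemma std_tab_CSvert b : b \in Bvert lam -> std_tab b \in CSvert lam.
Proof.
case/BvertP=> shape_b b_crystal; apply/CSvertP; rewrite rowword_std_tab.
split; last exact: iblock_std_last.
apply/and3P; split; first by rewrite shape_std_tab shape_b.
  apply/is_ssytP; rewrite shape_std_tab shape_b // rowword_std_tab.
  exact: ssyt_word_std.
by rewrite (perm_trans (perm_rowword _)) // rowword_std_tab crystal_std_perm.
Qed.

Lemma std_tabK : {in Bvert lam, cancel std_tab phi}.
Proof.
move=> b b_vert; have [shape_b b_crystal] := proj1 (BvertP b) b_vert.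
have /CSvertP[T_syt _] := std_tab_CSvert b_vert.
rewrite -[LHS]rowwordK (shape_phi T_syt) (rowword_phi lam_part T_syt N_gt0).
by rewrite rowword_std_tab (map_iblock_std lam_part) // -shape_b rowwordK.
Qed.

End Vertices.

(** * The bracketing rule *)

Section Brackets.

Variables (close open : pred nat).

Definition bracket_step (o x : nat) : nat :=
  if open x then o.+1 else if close x then o.-1 else o.

Definition pending (w : seq nat) : nat := foldl bracket_step 0 w.

(* The height of a prefix being its number of closing letters minus its number of opening
   letters, the rightmost unbracketed closing letter is the one that first brings the height to
   its maximum. *)
Definition rightmost_unbracketed (w : seq nat) (p : nat) : Prop :=
  [/\ p < size w, close (nth 0 w p),
      forall s, s <= p -> count close (take s w) + count open (take p w)
                          <= count close (take p w) + count open (take s w)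
    & forall s, p < s -> count close (take s w) + count open (take p w)
                          <= (count close (take p w) + count open (take s w)).+1].

Lemma pending_rcons w x : pending (rcons w x) = bracket_step (pending w) x.
Proof. exact: foldl_rcons. Qed.

Lemma pending_le_count w : pending w <= count open w.
Proof.
elim/last_ind: w => // w x IHw; rewrite pending_rcons /bracket_step count_rcons.
by case: (open x) => //=; case: (close x); lia.
Qed.

Hypothesis close_not_open : forall x, close x -> ~~ open x.

Lemma pending_leP w k : pending w <= k <->
  forall s, count close (take s w) + count open w
            <= count close w + count open (take s w) + k.
Proof.
elim/last_ind: w k => [|w x IHw] k; first by split.
rewrite (forall_take_rcons (fun u => count close u + count open (rcons w x)
           <= count close (rcons w x) + count open u + k)).
rewrite pending_rcons /bracket_step !count_rcons.
have shiftP k' : close x + k = open x + k' -> pending w <= k' <->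
    (forall s, count close (take s w) + (count open w + open x)
               <= count close w + close x + count open (take s w) + k) /\
    count close w + close x + (count open w + open x)
      <= count close w + close x + (count open w + open x) + k.
  move=> eq_k; rewrite IHw; split=> [h|[h _] s]; last by have := h s; lia.
  by split=> [s|]; [have := h s|]; lia.
case open_x: (open x).
  have close_x : close x = false by apply: contraTF open_x => /close_not_open.
  rewrite open_x close_x in shiftP *; case: k shiftP => [|k] shiftP; last exact: shiftP.
  by split=> // -[/(_ (size w))]; rewrite take_size; lia.
case close_x: (close x); rewrite open_x close_x in shiftP *; last exact: shiftP.
by rewrite -shiftP ?add1n //; lia.
Qed.

Lemma pending_eq0P w : pending w = 0 <->
  forall s, count close (take s w) + count open w <= count close w + count open (take s w).
Proof.
have -> : (pending w = 0) <-> pending w <= 0 by rewrite leqn0; split=> /eqP.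
by rewrite pending_leP; split=> h s; have := h s; lia.
Qed.

Lemma rightmost_unbracketed_pending w p : rightmost_unbracketed w p ->
  pending w = 0 <->
  count close w + count open (take p w) = (count close (take p w) + count open w).+1.
Proof.
case=> p_lt closing before after; rewrite pending_eq0P.
have := after _ p_lt; rewrite take_size => height_w.
split=> [best|height s].
  have := best p.+1; rewrite (take_nth 0 p_lt) !count_rcons closing.
  by rewrite (negbTE (close_not_open closing)); lia.
by have [sp|ps] := leqP s p; [have := before s sp | have := after s ps]; lia.
Qed.

Lemma rightmost_unbracketed_rcons_lt w x p : p < size w ->
  rightmost_unbracketed (rcons w x) p <-> rightmost_unbracketed w p /\
    count close (rcons w x) + count open (take p w)
      <= (count close (take p w) + count open (rcons w x)).+1.
Proof.
move=> p_lt; split=> [[_]|[[_ closing before after] last]].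
  rewrite nth_rcons p_lt => closing before after; split; first split=> //.
  - by move=> s sp; have := before s sp; rewrite !take_rcons_le //; lia.
  - move=> s ps; have := after (minn s (size w)).
    by rewrite !take_rcons_le ?geq_minr ?(ltnW p_lt) // take_min take_size; apply; lia.
  - by have := after (size w).+1; rewrite take_rcons_gt // take_rcons_le ?(ltnW p_lt) //; lia.
split; rewrite ?size_rcons ?nth_rcons ?p_lt ?take_rcons_le ?(ltnW p_lt) //.
- exact: ltnW.
- by move=> s sp; rewrite take_rcons_le; [apply: before | lia].
- move=> s ps; have [s_le|s_gt] := leqP s (size w); last by rewrite take_rcons_gt.
  by rewrite take_rcons_le //; apply: after.
Qed.

Lemma rightmost_unbracketed_last w x :
  rightmost_unbracketed (rcons w x) (size w) <-> close x /\ pending w = 0.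
Proof.
rewrite pending_eq0P; split=> [[_]|[closing best]].
  rewrite nth_rcons ltnn eqxx => closing before _; split=> // s.
  have [s_le|/ltnW s_gt] := leqP s (size w); last by rewrite take_oversize.
  by have := before s s_le; rewrite !take_rcons_le // take_size.
split; rewrite ?size_rcons ?nth_rcons ?ltnn ?eqxx //.
  by move=> s s_le; rewrite !take_rcons_le // take_size; apply: best.
move=> s s_gt; rewrite take_rcons_gt // take_rcons_le // take_size !count_rcons.
by rewrite closing (negbTE (close_not_open closing)); lia.
Qed.

Lemma rightmost_unbracketed_rcons w x p : rightmost_unbracketed (rcons w x) p <->
  if close x && (pending w == 0) then p = size w else rightmost_unbracketed w p.
Proof.
have [p_lt|size_le] := ltnP p (size w); last first.
  have [->|p_ne] := eqVneq p (size w).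
    rewrite rightmost_unbracketed_last; case: ifP => [/andP[-> /eqP ->]|not_last] //.
    by split=> [[closing /eqP pend]|[]]; [rewrite closing pend in not_last | rewrite ltnn].
  have not_rcons : ~ rightmost_unbracketed (rcons w x) p by case; rewrite size_rcons; lia.
  have not_w : ~ rightmost_unbracketed w p by case; lia.
  by case: ifP => _; split=> // e; rewrite e eqxx in p_ne.
rewrite rightmost_unbracketed_rcons_lt // !count_rcons.
case: ifP => [/andP[closing /eqP pend]|not_last].
  split=> [[RUp]|e]; last by rewrite e ltnn in p_lt.
  have := proj1 (rightmost_unbracketed_pending RUp) pend.
  by rewrite closing (negbTE (close_not_open closing)); lia.
split=> [[]|RUp] //; split=> //; have [_ _ _ /(_ _ p_lt)] := RUp; rewrite take_size.
move: not_last; case: (close x) => /= [/eqP pend|_]; last by lia.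
have : count close w + count open (take p w) <> (count close (take p w) + count open w).+1.
  by move/(rightmost_unbracketed_pending RUp).
by lia.
Qed.

End Brackets.

Lemma fpos_rcons j w x i o best : fpos j (rcons w x) i o best =
  if (x == j) && (foldl (bracket_step (pred1 j) (pred1 j.+1)) o w == 0)
  then Some (i + size w) else fpos j w i o best.
Proof.
elim: w i o best => [|y w IHw] i o best /=.
  have [->|xj] := eqVneq x j; last by case: ifP.
  have -> : (j == j.+1) = false by lia.
  by rewrite addn0; case: o.
rewrite /bracket_step /= addnS -addSn; case: ifP => _; first exact: IHw.
by case: ifP => _; last exact: IHw; case: o => [|o]; apply: IHw.
Qed.

Definition f_position (j : nat) : seq nat -> nat -> Prop :=
  rightmost_unbracketed (pred1 j) (pred1 j.+1).

Lemma fposP j w p : fpos j w 0 0 None = Some p <-> f_position j w p.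
Proof.
have disjoint x : pred1 j x -> ~~ pred1 j.+1 x by move=> /= /eqP ->; lia.
rewrite /f_position; elim/last_ind: w => [|w x IHw]; first by split=> // -[].
rewrite fpos_rcons add0n rightmost_unbracketed_rcons // -/(pending _ _ w).
by case: ifP => // _; split=> [[]|->].
Qed.

Lemma f_tabE j t p : f_position j (rowword t) p ->
  f_tab j t = Some (tab_of_word (shape t) (set_nth 0 (rowword t) p j.+1)).
Proof. by move=> /fposP pos_p; rewrite /f_tab /f_word pos_p. Qed.

Lemma f_tabP j t b : f_tab j t = Some b -> exists2 p, f_position j (rowword t) p
  & b = tab_of_word (shape t) (set_nth 0 (rowword t) p j.+1).
Proof.
rewrite /f_tab /f_word; case pos_p: (fpos _ _ _ _ _) => [p|] //= [<-].
by exists p => //; apply/fposP.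
Qed.

(** * Crystal operators preserve semistandardness *)

Lemma f_position_next j v p : f_position j v p -> p.+1 < size v -> nth 0 v p.+1 != j.
Proof.
case=> _ /= /eqP letter_p _ /(_ p.+2) after p1_lt; apply/eqP => letter_p1; move: after.
rewrite !(take_nth 0) ?(ltnW p1_lt) // !count_rcons letter_p letter_p1 /= eqxx.
by rewrite (_ : j == j.+1 = false); lia.
Qed.

Section SsytWords.

Variables (lam v : seq nat).
Hypotheses (lam_part : is_partition lam) (size_v : size v = sumn lam).
Hypothesis v_ssyt : ssyt_word lam v.

Lemma count_ge_row_above r c a y : c < nth 0 lam r.+1 ->
  (forall k, a <= k <= c -> nth 0 v (cell_pos lam r.+1 k) = y) ->
  c.+1 - a <= count (fun q => nth 0 v q == y)
                (iota (cell_pos lam r.+1 a) (cell_pos lam r c - cell_pos lam r.+1 a)).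
Proof.
move=> c_above above_y; have a_E := cell_posE lam r.+1 a.
have := cell_pos_lt c (ltnSn r) c_above; rewrite (cell_posE _ _ c) => c_lt.
rewrite -[c.+1 - a](subnDl (cell_pos lam r.+1 0)); apply: count_ge_range => q hq.
rewrite mem_iota; apply/andP; split; first by lia.
have -> : q = cell_pos lam r.+1 (q - cell_pos lam r.+1 0).
  by rewrite [RHS]cell_posE subnKC //; lia.
by rewrite above_y //; lia.
Qed.

Lemma count_le_row r c a y : a < nth 0 lam r.+1 -> c < nth 0 lam r ->
  (forall k, nth 0 v (cell_pos lam r k) == y -> a <= k) ->
  y < nth 0 v (cell_pos lam r.+1 a) ->
  count (fun q => nth 0 v q == y)
    (iota (cell_pos lam r.+1 a) (cell_pos lam r c - cell_pos lam r.+1 a)) <= c - a.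
Proof.
move=> a_above c_row a_min y_above; have a_lt := cell_pos_lt c (ltnSn r) a_above.
rewrite -[c - a](subnDl (cell_pos lam r 0)); apply: count_le_range; first exact: iota_uniq.
move=> q; rewrite mem_iota -!cell_posE => hq.
have [a_q q_c] : cell_pos lam r.+1 a <= q /\ q < cell_pos lam r c by lia.
rewrite q_c andbT.
have [r' [c' [c'_row q_E]]] : exists r c, c < nth 0 lam r /\ q = cell_pos lam r c.
  by apply/cell_posP/(ltn_trans q_c)/cell_pos_bound.
have := cell_posE lam r' c'; rewrite -q_E => q_E' /eqP letter_q.
have [r'r|rr'|rr'] := ltngtP r' r.
- by have := cell_pos_lt c' r'r c_row; lia.
- have [rr1|r1r'] := leqP r' r.+1; last by have := cell_pos_lt a r1r' c'_row; lia.
  have r'_E : r' = r.+1 by lia.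
  rewrite r'_E in c'_row q_E q_E'; have := ssyt_word_row v_ssyt (c := a) (c' := c') _ c'_row.
  by have := cell_posE lam r.+1 a; rewrite -q_E letter_q; lia.
- rewrite rr' in q_E q_E'; have := a_min c'; have := cell_posE lam r a.
  by rewrite -q_E letter_q eqxx; lia.
Qed.

(* Otherwise the letters [j] of row [r] up to column [c] all lie below letters [j.+1] of row
   [r.+1], which bracket them. *)
Lemma f_position_above j r c : f_position j v (cell_pos lam r c) ->
  c < nth 0 lam r.+1 -> nth 0 v (cell_pos lam r.+1 c) != j.+1.
Proof.
case=> _ /= letter_p before _ c_above; apply/eqP => above.
have c_row : c < nth 0 lam r := leq_trans c_above (partition_nth r lam_part).
have row_le := ssyt_word_row v_ssyt.
have [a /eqP first_a a_min] :=
  ex_minnP (ex_intro (fun k => nth 0 v (cell_pos lam r k) == j) c letter_p).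
have ac := a_min c letter_p.
have above_j1 k : a <= k <= c -> nth 0 v (cell_pos lam r.+1 k) = j.+1.
  move=> hk; have [k_above k_row] : k < nth 0 lam r.+1 /\ k < nth 0 lam r by lia.
  have := row_le r.+1 k c; have := proj2 v_ssyt r k k_above; have := row_le r a k; lia.
have a_above : a < nth 0 lam r.+1 by lia.
have := count_le_row a_above c_row a_min; have := count_ge_row_above c_above above_j1.
rewrite above_j1 ?leqnn // => opening /(_ isT) closing.
have a_lt := cell_pos_lt c (ltnSn r) a_above.
have p_lt := cell_pos_bound c_row; rewrite -size_v in p_lt.
have split_p P := @count_take_split P v (cell_pos lam r.+1 a) (cell_pos lam r c).
by have := before _ (ltnW a_lt); rewrite !split_p ?(ltnW a_lt) ?(ltnW p_lt) //=; lia.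
Qed.

Lemma ssyt_word_f j p : f_position j v p -> ssyt_word lam (set_nth 0 v p j.+1).
Proof.
move=> pos_p; have [_ /= /eqP letter_p _ _] := pos_p; have [rows cols] := v_ssyt.
split=> r c hc; rewrite !nth_set_nth /=.
  have [cell_p|_] := eqVneq (cell_pos lam r c) p; last first.
    by have := rows r c hc; case: eqP => [->|_] //; rewrite letter_p; lia.
  have right_p : cell_pos lam r c.+1 = p.+1 by rewrite -cell_p /cell_pos addnS.
  have := cell_pos_bound hc; rewrite right_p -size_v => /(f_position_next pos_p).
  by have := rows r c hc; rewrite cell_p right_p letter_p; case: (eqVneq p.+1 p); lia.
have := cols r c hc; have [cell_p|_] := eqVneq (cell_pos lam r c) p; last first.
  by case: eqP => [->|_] //; rewrite letter_p; lia.
rewrite -cell_p in pos_p letter_p *; have := f_position_above pos_p hc.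
have := cell_pos_lt c (ltnSn r) hc; rewrite letter_p.
by case: (eqVneq (cell_pos lam r.+1 c) (cell_pos lam r c)); lia.
Qed.

End SsytWords.

Lemma crystal_word_f lam v j p : is_partition lam -> crystal_word lam v ->
  j < size lam -> f_position j v p -> crystal_word lam (set_nth 0 v p j.+1).
Proof.
move=> lam_part [size_v v_ssyt range] j_lt pos_p; have [p_lt _ _ _] := pos_p.
split; first by rewrite size_set_nth size_v; apply/maxn_idPr; rewrite -size_v.
  exact: ssyt_word_f.
by move=> q hq; rewrite nth_set_nth /=; case: eqP => // _; apply: range.
Qed.

(** * Row insertion *)

Lemma ins_rows_append r t x : {in r, forall z, z <= x} -> ins_rows (r :: t) x = rcons r x :: t.
Proof.
move=> r_le /=; rewrite (_ : find _ r < size r = false) //.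
by rewrite -has_find; apply/hasP => -[z /r_le]; lia.
Qed.

Lemma ins_rows_bump r1 y r2 t x : x < y -> {in r1, forall z, z <= x} ->
  ins_rows ((r1 ++ y :: r2) :: t) x = (r1 ++ x :: r2) :: ins_rows t y.
Proof.
move=> xy r1_le; have find_y : find (fun z => x < z) (r1 ++ y :: r2) = size r1.
  rewrite find_cat /= xy addn0; case: ifP => // /hasP[z /r1_le]; lia.
rewrite /= find_y size_cat /= addnS ltnS leq_addr nth_cat ltnn subnn /=.
congr (_ :: _); rewrite set_nthE size_cat /= addnS ltnS leq_addr take_size_cat //.
by rewrite -[r1 ++ y :: _]cat_rcons drop_size_cat ?size_rcons.
Qed.

Lemma row_insertionP (r : seq nat) x : {in r, forall z, z <= x} \/
  exists r1 y r2, [/\ r = r1 ++ y :: r2, x < y & {in r1, forall z, z <= x}].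
Proof.
have [/(split_find_nth 0)[y r1 r2 xy r1_le]|r_le] := boolP (has (ltn x) r); [right|left].
  exists r1, y, r2; split; rewrite // ?cat_rcons // => z zr1.
  by rewrite leqNgt; apply: contra r1_le => xz; apply/hasP; exists z.
by move=> z zr; rewrite leqNgt; apply: (hasPn r_le).
Qed.

Lemma perm_ins_rows t x : perm_eq (flatten (ins_rows t x)) (x :: flatten t).
Proof.
elim: t x => [|r t IHt] x; first by [].
have [r_le|[r1 [y [r2 [-> xy r1_le]]]]] := row_insertionP r x.
  by rewrite ins_rows_append //= cat_rcons -cat1s -[x :: _]cat1s perm_catCA.
rewrite ins_rows_bump //=; apply: (@perm_trans _ ((r1 ++ x :: r2) ++ y :: flatten t)).
  by rewrite perm_cat2l.
by apply/permP => P; rewrite /= !count_cat /=; lia.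
Qed.

Definition consecutive_subword (d : nat) (w : seq nat) : seq nat :=
  [seq z <- w | (z == d) || (z == d.+1)].

Lemma consecutive_subword_cat d u v :
  consecutive_subword d (u ++ v) = consecutive_subword d u ++ consecutive_subword d v.
Proof. exact: filter_cat. Qed.

Lemma consecutive_subword_nil d u :
  {in u, forall z, (z < d) || (d.+1 < z)} -> consecutive_subword d u = [::].
Proof.
move=> far; rewrite /consecutive_subword -(filter_pred0 u).
by apply: eq_in_filter => z /far /=; lia.
Qed.

Lemma idescent_consecutive_subword d w : idescent (consecutive_subword d w) d = idescent w d.
Proof. by apply: index_filter_lt; rewrite eqxx ?orbT. Qed.

(* An elementary Knuth transformation never exchanges consecutive values. *)
Lemma consecutive_subword_bump d r1 x y r2 : x < y ->
  {in r1, forall z, z < x} -> {in r2, forall z, y < z} ->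
  consecutive_subword d ([:: y] ++ r1 ++ [:: x] ++ r2)
  = consecutive_subword d (r1 ++ [:: y] ++ r2 ++ [:: x]).
Proof.
move=> xy r1_lt r2_gt; rewrite !consecutive_subword_cat.
have y_r1 : consecutive_subword d [:: y] = [::] \/ consecutive_subword d r1 = [::].
  have [y_d|y_d] := boolP ((y == d) || (y == d.+1)).
    by right; apply: consecutive_subword_nil => z /r1_lt; lia.
  by left; apply: consecutive_subword_nil => z; rewrite inE => /eqP ->; lia.
have x_r2 : consecutive_subword d [:: x] = [::] \/ consecutive_subword d r2 = [::].
  have [x_d|x_d] := boolP ((x == d) || (x == d.+1)).
    by right; apply: consecutive_subword_nil => z /r2_gt; lia.
  by left; apply: consecutive_subword_nil => z; rewrite inE => /eqP ->; lia.
by case: y_r1 => ->; case: x_r2 => ->; rewrite ?cats0 ?cat0s.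
Qed.

Lemma ins_rows_inv t x : all (sorted ltn) t -> uniq (x :: flatten t) ->
  all (sorted ltn) (ins_rows t x) /\ forall d,
    consecutive_subword d (rowword (ins_rows t x)) = consecutive_subword d (rowword t ++ [:: x]).
Proof.
elim: t x => [|r t IHt] x //; rewrite [all _ _]/= => /andP[r_sorted t_sorted] xrt_uniq.
have xr : x \notin r by move: xrt_uniq; rewrite /= mem_cat negb_or -andbA => /andP[].
have [r_le|[r1 [y [r2 [r_E xy r1_le]]]]] := row_insertionP r x.
  rewrite ins_rows_append //; split; last by move=> d; rewrite !rowword_cons -cats1 catA.
  rewrite /= t_sorted andbT; case: r r_sorted xr r_le {xrt_uniq} => //= a s s_path xs s_le.
  rewrite rcons_path s_path /= ltn_neqAle s_le ?mem_last ?andbT //.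
  by apply: contraNneq xs => <-; apply: mem_last.
rewrite {r}r_E in r_sorted xrt_uniq xr *; rewrite ins_rows_bump //.
have yt_uniq : uniq (y :: flatten t).
  move: xrt_uniq; rewrite [flatten _]/= -catA -cat_cons cat_uniq => /and3P[_ _].
  by rewrite cat_cons /= mem_cat negb_or cat_uniq -andbA => /and4P[_ -> _ /andP[]].
have r1_lt : {in r1, forall z, z < x}.
  move=> z zr1; rewrite ltn_neqAle r1_le // andbT.
  by apply: contraNneq xr => <-; rewrite mem_cat zr1.
have [t_ins_sorted t_ins_subword] := IHt y t_sorted yt_uniq.
move: r_sorted; rewrite !(sorted_pairwise ltn_trans) pairwise_cat /= allrel_consr.
case/and3P=> /andP[r1_y r1_r2] r1_sorted /andP[/allP y_r2 r2_sorted].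
split=> [|d].
  rewrite /= t_ins_sorted andbT (sorted_pairwise ltn_trans) pairwise_cat /= allrel_consr.
  rewrite r1_r2 r1_sorted r2_sorted !andbT /=; apply/andP; split; apply/allP => z zr.
    exact: r1_lt.
  exact: ltn_trans xy (y_r2 z zr).
rewrite !rowword_cons consecutive_subword_cat t_ins_subword -consecutive_subword_cat -!catA.
rewrite !(consecutive_subword_cat d (rowword t)); congr cat.
exact: consecutive_subword_bump.
Qed.

Lemma idescent_rsk_P (w : seq nat) d : uniq w -> idescent (rowword (rsk_P w)) d = idescent w d.
Proof.
move=> w_uniq; rewrite -idescent_consecutive_subword -[RHS]idescent_consecutive_subword.
congr (idescent _ d); suff : [/\ all (sorted ltn) (rsk_P w), perm_eq (flatten (rsk_P w)) w
    & consecutive_subword d (rowword (rsk_P w)) = consecutive_subword d w] by case.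
rewrite /rsk_P; elim/last_ind: w w_uniq => // w x IHw; rewrite rcons_uniq foldl_rcons.
case/andP=> xw w_uniq; have [P_sorted P_perm P_subword] := IHw w_uniq.
have xP_uniq : uniq (x :: flatten (foldl ins_rows [::] w)).
  by rewrite /= (perm_mem P_perm) xw (perm_uniq P_perm) w_uniq.
have [ins_sorted ins_subword] := ins_rows_inv P_sorted xP_uniq; split=> //.
  by rewrite (perm_trans (perm_ins_rows _ _)) // perm_sym perm_rcons perm_cons perm_sym.
by rewrite ins_subword -cats1 !consecutive_subword_cat P_subword.
Qed.

Lemma dyck_interval_idescent (w : seq nat) i m d : uniq w -> dyck_interval w i m ->
  i <= d < i + 2 * m -> idescent w d = (d == i + m).
Proof.
move=> w_uniq /and4P[m_gt0 _ _ /eqP rsk_w] hd.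
transitivity (idescent [seq x <- w | i <= x <= i + 2 * m] d).
  by apply/esym/index_filter_lt; lia.
rewrite -idescent_rsk_P ?filter_uniq // rsk_w !rowword_cons cat0s.
rewrite /idescent !index_cat !mem_iota size_iota.
by case: ifP => high_d1; case: ifP => high_d; rewrite !index_iota_sub; lia.
Qed.

(* The tableau after inserting a shuffle of [i, ..., i + k - 1] and [e + 1, ..., e + l], when
   [s] letters of the second kind have been bumped. *)
Definition two_row (i e k l s : nat) : tableau :=
  if k + l == 0 then [::]
  else if s == 0 then [:: iota i k ++ iota e.+1 l]
  else [:: iota i k ++ iota (e.+1 + s) (l - s); iota e.+1 s].

Lemma ins_two_row_high i e k l s : s <= l -> i + k <= e.+1 ->
  ins_rows (two_row i e k l s) (e.+1 + l) = two_row i e k l.+1 s.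
Proof.
move=> sl ke; rewrite /two_row addnS /=; case: eqP => [kl0|_].
  by have [-> -> ->] : [/\ s = 0, k = 0 & l = 0] by [split; lia]; rewrite /= addn0.
have [_|s_gt0] := eqVneq s 0.
  by rewrite ins_rows_append ?rcons_cat ?rcons_iota // => z; rewrite mem_cat !mem_iota; lia.
rewrite ins_rows_append => [|z]; last by rewrite mem_cat !mem_iota; lia.
by rewrite rcons_cat (_ : e.+1 + l = e.+1 + s + (l - s)) ?rcons_iota ?subSn //; lia.
Qed.

Lemma ins_two_row_low i e k l s : s <= l -> i + k <= e ->
  ins_rows (two_row i e k l s) (i + k) = two_row i e k.+1 l (if s < l then s.+1 else s).
Proof.
move=> sl ke; rewrite /two_row addSn /=; case: eqP => [kl0|_].
  by have [-> -> ->] : [/\ s = 0, k = 0 & l = 0] by [split; lia]; rewrite /= addn0.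
have low_le : {in iota i k, forall z, z <= i + k} by move=> z; rewrite mem_iota; lia.
have bump t : s < l -> ins_rows ((iota i k ++ iota (e.+1 + s) (l - s)) :: t) (i + k)
   = (iota i k.+1 ++ iota (e.+1 + s.+1) (l - s.+1)) :: ins_rows t (e.+1 + s).
  move=> s_lt; have -> : l - s = (l - s.+1).+1 by lia.
  by rewrite ins_rows_bump //; [rewrite -rcons_iota cat_rcons addnS | lia].
have [s_lt|l_le] := ltnP s l.
  have [s0|s_gt0] := eqVneq s 0.
    by have := bump [::] s_lt; rewrite s0 addn0 subn0 => ->; rewrite /= addn1.
  rewrite bump // ins_rows_append ?rcons_iota // => z; rewrite mem_iota; lia.
have -> : s = l by lia.
rewrite subnn !cats0; have [->|l_gt0] := eqVneq l 0; rewrite ?cats0.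
  by rewrite ins_rows_append ?rcons_iota.
by rewrite ins_rows_append ?rcons_iota.
Qed.

Lemma rsk_P_two_row i e u k l :
  [seq x <- u | x <= e] = iota i k -> [seq x <- u | e < x] = iota e.+1 l -> i + k <= e.+1 ->
  rsk_P u = two_row i e k l (l - pending (geq e) (ltn e) u).
Proof.
rewrite /rsk_P; elim/last_ind: u k l => [|u x IHu] k l /=.
  by case: k => // _; case: l.
rewrite !filter_rcons foldl_rcons pending_rcons /bracket_step /=.
have [x_high|x_low] := ltnP e x.
  move=> low_k /rcons_iotaP[l' -> [high_l ->]] ke; rewrite (IHu k l') //.
  have := pending_le_count (geq e) (ltn e) u; rewrite -size_filter high_l size_iota => pend_le.
  by rewrite ins_two_row_high ?leq_subr //; congr two_row; lia.
move=> /rcons_iotaP[k' -> [low_k ->]] high_l ke; rewrite (IHu k' l) //; last by lia.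
have := pending_le_count (geq e) (ltn e) u; rewrite -size_filter high_l size_iota => pend_le.
by rewrite ins_two_row_low ?leq_subr //; [congr two_row; case: ifP|]; lia.
Qed.

Lemma pending_filter (close open P : pred nat) w :
  pending close open (filter P w) = pending (predI close P) (predI open P) w.
Proof.
elim/last_ind: w => // w x IHw; rewrite filter_rcons pending_rcons /bracket_step /= -IHw.
by case: (P x); rewrite ?pending_rcons /bracket_step /= ?andbT ?andbF.
Qed.

Lemma eq_pending (close close' open open' : pred nat) w :
  close =1 close' -> open =1 open' -> pending close open w = pending close' open' w.
Proof.
move=> eq_close eq_open; elim/last_ind: w => // w x IHw.
by rewrite !pending_rcons /bracket_step eq_close eq_open IHw.
Qed.

Lemma dyck_intervalI N (w : seq nat) i m :
  perm_eq w (iota 1 N) -> 0 < i -> 0 < m -> i + 2 * m <= N ->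
  in_order w i.-1 (i + m) -> in_order w (i + m) (i + m + m) ->
  (forall s, count (itv i.-1 (i + m)) (take s w)
             <= (count (itv (i + m) (i + m + m)) (take s w)).+1) ->
  dyck_interval w i m.
Proof.
move=> w_perm i_gt0 m_gt0 im_le low_ordered high_ordered height_le.
rewrite /dyck_interval m_gt0 i_gt0 (size_perm_iota w_perm) im_le /=; apply/eqP.
set u := filter _ w.
have low_u : [seq x <- u | x <= i + m] = iota i m.+1.
  rewrite -filter_predI; apply: (filter_perm_iota w_perm) => [||x|] //=; rewrite ?addnS //; lia.
have high_u : [seq x <- u | i + m < x] = iota (i + m).+1 m.
  rewrite -filter_predI; apply: (filter_perm_iota w_perm) => [||x|] //=; lia.
rewrite (rsk_P_two_row low_u high_u) ?addnS //.
suff -> : pending (geq (i + m)) (ltn (i + m)) u = 0.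
  by rewrite subn0 /two_row addSn (negbTE (lt0n_neq0 m_gt0)) subnn cats0.
rewrite pending_filter (@eq_pending _ (itv i.-1 (i + m)) _ (itv (i + m) (i + m + m))).
- apply/pending_eq0P => [x|s]; first by rewrite /itv; lia.
  rewrite !(count_itv_perm w_perm); [|lia..].
  by have := height_le s; lia.
- by move=> x; rewrite /itv /=; lia.
- by move=> x; rewrite /itv /=; lia.
Qed.

(** * Unbracketed letters and intervals of values *)

Definition consecutive_runs (N : nat) (w : seq nat) (lo mid hi : nat) : Prop :=
  [/\ lo <= mid, mid <= hi, hi <= N, in_order w lo mid & in_order w mid hi].

Section Intervals.

Variables (N : nat) (w : seq nat).
Hypothesis w_perm : perm_eq w (iota 1 N).

Lemma f_position_map (g : nat -> nat) j lo mid hi p :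
  (forall x, 0 < x <= N -> (g x == j) = itv lo mid x) ->
  (forall x, 0 < x <= N -> (g x == j.+1) = itv mid hi x) ->
  f_position j (map g w) p <-> rightmost_unbracketed (itv lo mid) (itv mid hi) w p.
Proof.
move=> lowE highE; have countE h (P : pred nat) s : (forall x, 0 < x <= N -> (g x == h) = P x) ->
    count (pred1 h) (take s (map g w)) = count P (take s w).
  move=> PE; rewrite -map_take count_map; apply: eq_in_count => x /mem_take.
  by rewrite (mem_perm_iota w_perm) => /PE.
have low_count s := countE _ _ s lowE; have high_count s := countE _ _ s highE.
rewrite /f_position /rightmost_unbracketed size_map (size_perm_iota w_perm).
have [p_lt|p_ge] := ltnP p N; last by split=> -[].
rewrite (nth_map 0) ?(size_perm_iota w_perm) //= lowE ?(nth_perm_iota w_perm) //.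
split=> -[_ closing before after]; split=> // s hs.
- by have := before s hs; rewrite !(low_count, high_count).
- by have := after s hs; rewrite !(low_count, high_count).
- by rewrite !(low_count, high_count); apply: before.
- by rewrite !(low_count, high_count); apply: after.
Qed.

Variables lo mid hi : nat.
Hypothesis runs : consecutive_runs N w lo mid hi.

Lemma prefix_thresholds s : exists tl th, [/\ lo <= tl <= mid, mid <= th <= hi,
  forall x, itv lo mid x -> (index x w < s) = (x <= tl),
  forall x, itv mid hi x -> (index x w < s) = (x <= th) &
  forall a b, lo <= a -> b <= hi ->
    count (itv a mid) (take s w) = tl - a /\ count (itv mid b) (take s w) = minn b th - mid].
Proof.
have [lo_mid mid_hi hi_le low_ordered high_ordered] := runs.
have [|tl [tl_le tlP tl_count]] := prefix_in_order w_perm s _ low_ordered; first by lia.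
have [|th [th_le thP th_count]] := prefix_in_order w_perm s _ high_ordered; first by lia.
exists tl, th; split=> // a b lo_a b_hi; rewrite tl_count ?th_count //.
by split=> //; congr (_ - _); lia.
Qed.

Lemma prefix_counts_nth p : p < N -> itv lo mid (nth 0 w p) ->
  let a := count (itv mid hi) (take p w) in
  [/\ mid + a <= hi, forall x, itv mid hi x -> (index x w < p) = (x <= mid + a),
      forall c, lo <= c -> count (itv c mid) (take p w) = (nth 0 w p).-1 - c
    & forall m, mid + m <= hi -> count (itv mid (mid + m)) (take p w) = minn m a].
Proof.
have [_ _ _ low_ordered _] := runs.
move=> p_lt x_low; have index_x := index_nth_perm w_perm p_lt.
set x := nth 0 w p in x_low index_x *.
have [tl [th [tl_le th_le tlP thP counts]]] := prefix_thresholds p.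
have tl_E : tl = x.-1.
  have := tlP x x_low; have := tlP x.-1; have := low_ordered x.-1 x.
  by move: x_low; rewrite index_x /itv; lia.
have a_E : mid + count (itv mid hi) (take p w) = th.
  by have [_ ->] := counts lo hi (leqnn _) (leqnn _); lia.
rewrite /= a_E; split=> // [|c lo_c|m m_hi].
- by case/andP: th_le.
- by have [-> _] := counts c hi lo_c (leqnn _); rewrite tl_E.
- by have [_ ->] := counts lo _ (leqnn _) m_hi; rewrite -a_E -addn_minr addKn.
Qed.

Variable p : nat.
Let a := count (itv mid hi) (take p w).

Lemma rightmost_unbracketed_bounds : rightmost_unbracketed (itv lo mid) (itv mid hi) w p ->
  lo + a < nth 0 w p /\ mid + mid + a <= nth 0 w p + hi.
Proof.
have [lo_mid mid_hi hi_le _ _] := runs.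
case; rewrite (size_perm_iota w_perm) -/a => p_lt x_low before after.
have [_ _ /(_ lo (leqnn _)) lowp _] := prefix_counts_nth p_lt x_low.
have := before 0 isT; rewrite take0 lowp /= => height0.
have := after N p_lt; rewrite lowp -{1 2}(size_perm_iota w_perm) !take_size.
rewrite !(count_itv_perm w_perm) ?(leq_trans mid_hi) // => heightN.
by rewrite /itv in x_low; lia.
Qed.

(* The interval is cut down to the last [a] letters of the lower interval before [p], the letter
   at [p] and those after [p], together with their brackets. *)
Section Shrink.

Variables i m : nat.
Hypotheses (i_E : i + a = nth 0 w p) (m_E : i + m = mid).
Hypothesis unbracketed : rightmost_unbracketed (itv lo mid) (itv mid hi) w p.

Lemma shrink_bounds : [/\ lo < i, mid + m <= hi & a <= m].
Proof.
have [lo_x mid_x] := rightmost_unbracketed_bounds unbracketed.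
by have [_ x_low _ _] := unbracketed; rewrite /itv in x_low; split; lia.
Qed.

Lemma shrink_heights s :
  count (itv i.-1 mid) (take s w) <= (count (itv mid (mid + m)) (take s w)).+1.
Proof.
have [lo_i m_hi _] := shrink_bounds; have lo_i1 : lo <= i.-1 by lia.
have [p_lt x_low before after] := unbracketed; rewrite (size_perm_iota w_perm) in p_lt.
have [_ _ /(_ lo (leqnn _)) lowp _] := prefix_counts_nth p_lt x_low.
have [tl [th [tl_le th_le _ _ counts]]] := prefix_thresholds s.
have [-> ->] := counts _ _ lo_i1 m_hi; have [low high] := counts lo hi (leqnn _) (leqnn _).
have height_s : tl - lo + a <= ((nth 0 w p).-1 - lo + (th - mid)).+1.
  rewrite -low -lowp -[th](minn_idPr (proj2 (andP th_le))) -high.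
  by have [/before/leqW|/after] := leqP s p.
have {}height_s : tl <= i + (th - mid) by rewrite -i_E in height_s; lia.
by rewrite leq_subLR minnE; lia.
Qed.

Lemma shrink_beyond y : itv (mid + m) hi y -> p < index y w.
Proof.
have [_ _ hi_le _ _] := runs; have [lo_i m_hi a_m] := shrink_bounds.
have [p_lt x_low _ _] := unbracketed.
rewrite (size_perm_iota w_perm) in p_lt; have index_x := index_nth_perm w_perm p_lt.
have [_ highP _ _] := prefix_counts_nth p_lt x_low; rewrite /itv => hy.
have := index_perm_inj w_perm (x := y) (y := nth 0 w p); rewrite index_x -i_E -/a.
by have := highP y; rewrite -/a /itv; lia.
Qed.

Lemma rightmost_unbracketed_shrink :
  rightmost_unbracketed (itv i.-1 mid) (itv mid (mid + m)) w p.
Proof.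
have [lo_i m_hi a_m] := shrink_bounds; have lo_i1 : lo <= i.-1 by lia.
have [p_lt x_low before _] := unbracketed; rewrite (size_perm_iota w_perm) in p_lt.
have [a_hi highP lowp /(_ m m_hi) highp] := prefix_counts_nth p_lt x_low.
rewrite -/a in a_hi highP highp; rewrite (minn_idPr a_m) in highp.
have window_lowp : count (itv i.-1 mid) (take p w) = a by rewrite lowp // -i_E; lia.
split; rewrite ?(size_perm_iota w_perm) // ?window_lowp ?highp.
- by rewrite -i_E /itv; lia.
- move=> s sp; have := before s sp; rewrite lowp // -/a -i_E.
  have [tl [th [tl_le th_le _ thP counts]]] := prefix_thresholds s.
  have [-> ->] := counts _ _ lo_i1 m_hi; have [-> ->] := counts lo hi (leqnn _) (leqnn _).
  suff : th <= mid + a by lia.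
  have [->|th_mid] := eqVneq th mid; first exact: leq_addr.
  have th_high : itv mid hi th by rewrite /itv; lia.
  by rewrite -(highP th th_high) (leq_trans _ sp) // thP.
- by move=> s _; have := shrink_heights s; lia.
Qed.

End Shrink.

Lemma rightmost_unbracketed_widen i m : lo < i -> i + m = mid -> mid + m <= hi ->
  rightmost_unbracketed (itv i.-1 mid) (itv mid (mid + m)) w p ->
  (forall y, itv (mid + m) hi y -> p < index y w) ->
  rightmost_unbracketed (itv lo mid) (itv mid hi) w p.
Proof.
move=> lo_i im m_hi [p_lt x_window before after] beyond; have lo_i1 : lo <= i.-1 by lia.
have x_low : itv lo mid (nth 0 w p) by rewrite /itv in x_window *; lia.
rewrite (size_perm_iota w_perm) in p_lt.
have [a_hi highP lowp /(_ m m_hi) highp] := prefix_counts_nth p_lt x_low.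
rewrite -/a in a_hi highP highp; rewrite /itv in x_window.
have a_m : a <= m.
  by have := beyond (mid + a); have := highP (mid + a); rewrite /itv; lia.
rewrite (minn_idPr a_m) in highp; rewrite highp !lowp // in before after.
have ia_x : i + a <= nth 0 w p by have := before 0 isT; rewrite take0 /=; lia.
split; rewrite ?(size_perm_iota w_perm) // ?lowp // -/a => s hs.
  have := before s hs; have [tl [th [tl_le th_le _ _ counts]]] := prefix_thresholds s.
  have [-> ->] := counts _ _ lo_i1 m_hi; have [-> ->] := counts lo hi (leqnn _) (leqnn _).
  rewrite (minn_idPr (proj2 (andP th_le))) => height_s.
  have {}height_s : tl + a <= (nth 0 w p).-1 + (th - mid) by lia.
  by lia.
have := after s hs; have [tl [th [tl_le th_le _ _ counts]]] := prefix_thresholds s.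
have [-> ->] := counts _ _ lo_i1 m_hi; have [-> ->] := counts lo hi (leqnn _) (leqnn _).
rewrite (minn_idPr (proj2 (andP th_le))) => height_s.
have {}height_s : tl + a <= nth 0 w p + (th - mid) by lia.
by lia.
Qed.

End Intervals.

(** * Dyck pattern intervals and crystal edges *)

Lemma f_position_iblock N w p j : perm_eq w (iota 1 N) -> 0 < j ->
  f_position j (map (iblock w) w) p <->
  rightmost_unbracketed (itv (block_end N w j.-1) (block_end N w j))
    (itv (block_end N w j) (block_end N w j.+1)) w p.
Proof.
by move=> w_perm j_gt0; apply: (f_position_map w_perm) => x hx; apply: (iblock_eq w_perm).
Qed.

Lemma block_runs N (w : seq nat) j : perm_eq w (iota 1 N) -> 0 < j ->
  consecutive_runs N w (block_end N w j.-1) (block_end N w j) (block_end N w j.+1).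
Proof.
move=> w_perm j_gt0; split; [exact: block_end_homo | exact: (block_end_homo N w j.+1)
  | exact: block_end_le | exact: block_in_order | exact: (block_in_order w_perm (ltn0Sn j))].
Qed.

Definition collapse_letter (i m x : nat) : nat :=
  if i <= x <= i + m then i else if i + m < x <= i + 2 * m then i.+1 else x.

Lemma rowword_collapse i m T :
  rowword (collapse i m T) = map (collapse_letter i m) (rowword T).
Proof. exact: rowword_map. Qed.

Lemma f_position_collapse N w p i m : perm_eq w (iota 1 N) -> 0 < i -> 0 < m ->
  f_position i (map (collapse_letter i m) w) p <->
  rightmost_unbracketed (itv i.-1 (i + m)) (itv (i + m) (i + m + m)) w p.
Proof.
move=> w_perm i_gt0 m_gt0; apply: (f_position_map w_perm) => x _;
  by rewrite /collapse_letter /itv; case: ifP => x_low; [|case: ifP => x_high]; lia.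
Qed.

Definition spans_blocks (w : seq nat) (i m j : nat) : Prop :=
  [/\ 0 < i, 0 < m, forall x, i <= x <= i + m -> iblock w x = j
    & forall x, i + m < x <= i + 2 * m -> iblock w x = j.+1].

Definition no_earlier_opening (N : nat) (w : seq nat) (e j p : nat) : Prop :=
  forall y, e < y <= N -> iblock w y = j.+1 -> p < index y w.

Lemma spans_blocks_gt0 w i m j : spans_blocks w i m j -> 0 < j.
Proof. by case=> _ _ low _; rewrite -(low i) ?leqnn ?leq_addr. Qed.

Lemma dyck_interval_spans (w : seq nat) i m : uniq w -> dyck_interval w i m ->
  spans_blocks w i m (iblock w i).
Proof.
move=> w_uniq dyck; have desc := dyck_interval_idescent w_uniq dyck.
have [m_gt0 i_gt0 _ _] := and4P dyck.
have low k : k <= m -> iblock w (i + k) = iblock w i.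
  elim: k => [|k IHk] hk; first by rewrite addn0.
  by rewrite addnS iblockS ?desc ?IHk //; lia.
have high k : k < m -> iblock w (i + m + k).+1 = (iblock w i).+1.
  elim: k => [|k IHk] hk; rewrite iblockS ?desc; try lia.
    by rewrite addn0 low // eqxx addn1.
  by rewrite addnS IHk; lia.
split=> // x hx; first by rewrite -(low (x - i)); [congr iblock|]; lia.
by rewrite -(high (x - (i + m).+1)); [congr iblock|]; lia.
Qed.

Definition rotate_letter (e m x : nat) : nat :=
  if x == e then e + m else if e < x <= e + m then x.-1 else x.

Lemma rotate_letter_inj e m : injective (rotate_letter e m).
Proof. by move=> a b; rewrite /rotate_letter; repeat (case: ifP => ?); lia. Qed.

Section Window.

Variables (N : nat) (w : seq nat).
Hypothesis w_perm : perm_eq w (iota 1 N).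
Variables i m j : nat.
Hypotheses (spans : spans_blocks w i m j) (im_le : i + 2 * m <= N).

Lemma spans_blocks_runs : consecutive_runs N w i.-1 (i + m) (i + m + m).
Proof.
have [i_gt0 m_gt0 low high] := spans.
split; try lia; move=> x y hx hy; apply: (iblock_eq_index w_perm); try lia.
  by rewrite !low //; lia.
by rewrite !high //; lia.
Qed.

Lemma spans_block_end : [/\ block_end N w j.-1 < i, block_end N w j = i + m
  & i + 2 * m <= block_end N w j.+1].
Proof.
have [i_gt0 m_gt0 low high] := spans; have j_gt0 := spans_blocks_gt0 spans.
split.
- by rewrite ltnNge -(iblock_le w_perm) ?low; lia.
- apply/eqP; rewrite eqn_leq leqNgt -!(iblock_le w_perm) ?(low (i + m)) ?(high (i + m).+1); lia.
- by rewrite -(iblock_le w_perm) ?high; lia.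
Qed.

Lemma collapse_letter_lex x y : 0 < x -> x < y <= N ->
  (collapse_letter i m x < collapse_letter i m y) ||
    (collapse_letter i m x == collapse_letter i m y) && (index x w < index y w).
Proof.
have [_ _ _ low high] := spans_blocks_runs; move=> x_gt0 xy.
have := low x y; have := high x y; rewrite /collapse_letter.
by case: ifP => x_low; [|case: ifP => x_high];
  (case: ifP => y_low; [|case: ifP => y_high]); lia.
Qed.

Variable p : nat.
Hypothesis p_collapse : f_position i (map (collapse_letter i m) w) p.

Lemma window_position_lt : p < N.
Proof. by case: p_collapse; rewrite size_map (size_perm_iota w_perm). Qed.

Lemma window_unbracketed :
  rightmost_unbracketed (itv i.-1 (i + m)) (itv (i + m) (i + m + m)) w p.
Proof. by have [i_gt0 m_gt0 _ _] := spans; apply/(f_position_collapse _ w_perm). Qed.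

Lemma window_letter : i <= nth 0 w p <= i + m.
Proof. by have [i_gt0 _ _ _] := spans; case: window_unbracketed; rewrite /itv; lia. Qed.

Section NoEarlierOpening.

Hypothesis no_earlier : no_earlier_opening N w (i + 2 * m) j p.

Lemma std_collapse : std_word (set_nth 0 (map (collapse_letter i m) w) p i.+1)
                   = std_word (set_nth 0 (map (iblock w) w) p j.+1).
Proof.
have [i_gt0 m_gt0 low high] := spans; have p_lt := window_position_lt.
rewrite !(set_nth_map_perm w_perm) //; apply: (eq_std_word_map w_perm) => x y x_gt0 xy.
have index_p := index_nth_perm w_perm p_lt; have p_low := window_letter.
set x0 := nth 0 w p in index_p p_low *.
have [y_x0|y_x0] := eqVneq y x0.
  rewrite {y}y_x0 in xy *; have [e|_] := eqVneq x x0; first by lia.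
  have := @iblock_homo w x x0; rewrite (low x0) // /collapse_letter => block_x.
  have {}block_x : iblock w x < j.+1 by lia.
  by rewrite block_x; case: ifP => x_low; [|case: ifP => x_high]; lia.
have [x_x0|_] := eqVneq x x0.
  rewrite {x x_gt0}x_x0 index_p in xy *; rewrite /collapse_letter.
  have [y_low|y_low] := boolP (i <= y <= i + m); first by rewrite low //; lia.
  have [y_high|y_high] := boolP (i + m < y <= i + 2 * m); first by rewrite high //; lia.
  have := @iblock_homo w (i + 2 * m) y; rewrite high; last by lia.
  by have := @no_earlier y; lia.
rewrite (collapse_letter_lex x_gt0 xy).
have := @iblock_homo w x y x_gt0; have := iblock_eq_index w_perm x_gt0 xy; lia.
Qed.

Lemma f_position_uncollapse : f_position j (map (iblock w) w) p.
Proof.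
have [i_gt0 m_gt0 low high] := spans; have j_gt0 := spans_blocks_gt0 spans.
have [lo_lt mid_E hi_ge] := spans_block_end; have hi_le := block_end_le N w j.+1.
have runs := block_runs w_perm j_gt0.
have m_hi : i + m + m <= block_end N w j.+1 by lia.
apply/(f_position_iblock p w_perm j_gt0); rewrite mid_E in runs *.
apply: (rightmost_unbracketed_widen w_perm runs lo_lt erefl m_hi window_unbracketed) => y y_high.
have y_bounds : 0 < y <= N by move: y_high; rewrite /itv; lia.
apply: no_earlier; first by move: y_high; rewrite /itv; lia.
apply/eqP; rewrite (iblock_eq w_perm) //= mid_E.
by move: y_high; rewrite /itv; lia.
Qed.

End NoEarlierOpening.

Section EarlierOpening.

Variable y : nat.
Hypotheses (y_bounds : i + 2 * m < y <= N) (y_block : iblock w y = j.+1).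
Hypothesis y_before : index y w < p.

Lemma window_high_before x : i + m < x <= i + 2 * m -> index x w < p.
Proof.
have [i_gt0 _ _ high] := spans; move=> hx; apply: leq_ltn_trans y_before.
by apply: iblock_eq_index_le; [lia | rewrite high].
Qed.

Lemma blocked_counts :
  count (itv i.-1 (i + m)) (take p w) = (nth 0 w p).-1 - i.-1
  /\ count (itv (i + m) (i + m + m)) (take p w) = m.
Proof.
have [i_gt0 m_gt0 _ _] := spans; have [_ x_low _ _] := window_unbracketed.
have [a_hi highP lowp _] :=
  prefix_counts_nth w_perm spans_blocks_runs window_position_lt x_low.
split; first exact: lowp.
have : i + m + m <= i + m + count (itv (i + m) (i + m + m)) (take p w).
  by rewrite -highP ?window_high_before // /itv; lia.
by lia.
Qed.

(* All the upper letters of the window precede [p], so the lower ones must bracket them. *)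
Lemma blocked_letter : nth 0 w p = i + m.
Proof.
have [i_gt0 _ _ _] := spans; have [_ _ before _] := window_unbracketed.
have [lowp highp] := blocked_counts; have := before 0 isT.
by rewrite take0 lowp highp /=; have := window_letter; lia.
Qed.

Lemma blocked_index : index (i + m).+1 w < index (i + m).-1 w.
Proof.
have [i_gt0 m_gt0 _ _] := spans; have [_ _ before _] := window_unbracketed.
rewrite ltnNge; apply/negP => le_index; set s := index (i + m).+1 w in le_index.
have s_p : s < p by apply: window_high_before; lia.
have lt_index : index (i + m).-1 w < s.
  rewrite ltn_neqAle le_index andbT; apply/eqP => /(index_perm_inj w_perm); lia.
have [tl [th [tl_le th_le tlP thP counts]]] :=
  prefix_thresholds w_perm spans_blocks_runs s.
have tl_ge : (i + m).-1 <= tl by rewrite -tlP // /itv; lia.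
have th_E : th = i + m.
  have : ((i + m).+1 <= th) = false by rewrite -thP /s ?ltnn // /itv; lia.
  by lia.
have := before s (ltnW s_p); have [-> ->] := counts _ _ (leqnn _) (leqnn _).
have [-> ->] := blocked_counts; rewrite blocked_letter th_E minnE; lia.
Qed.

Let w' := map (rotate_letter (i + m) m) w.

Lemma rotate_perm : perm_eq w' (iota 1 N).
Proof.
have [i_gt0 m_gt0 _ _] := spans; have size_w := size_perm_iota w_perm.
apply: perm_iota_of_uniq; rewrite ?size_map //.
  by rewrite map_inj_uniq ?(uniq_perm_iota w_perm) //; apply: rotate_letter_inj.
move=> z /mapP[x]; rewrite (mem_perm_iota w_perm) /rotate_letter => hx ->.
by case: eqP => [?|?]; [|case: ifP => ?]; lia.
Qed.

Lemma index_rotate : [/\ forall z, z < i + m \/ i + 2 * m < z -> index z w' = index z w,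
  forall z, i + m <= z < i + 2 * m -> index z w' = index z.+1 w
  & index (i + 2 * m) w' = p].
Proof.
have index_map_rotate x : index (rotate_letter (i + m) m x) w' = index x w.
  by rewrite index_map //; apply: rotate_letter_inj.
have index_p := index_nth_perm w_perm window_position_lt; rewrite blocked_letter in index_p.
split=> [z hz|z hz|]; rewrite -1?index_p -index_map_rotate; congr index;
  by rewrite /rotate_letter; repeat (case: ifP => ?); lia.
Qed.

Lemma std_collapse_blocked :
  std_word (set_nth 0 (map (collapse_letter i m) w) p i.+1) = w'.
Proof.
have [i_gt0 m_gt0 _ _] := spans; have [_ _ _ low_ordered high_ordered] := spans_blocks_runs.
pose level z := if i <= z < i + m then i else if i + m <= z <= i + 2 * m then i.+1 else z.
have -> : set_nth 0 (map (collapse_letter i m) w) p i.+1 = map level w'.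
  rewrite (set_nth_map_perm w_perm) ?window_position_lt // -map_comp; apply: eq_map => x /=.
  rewrite blocked_letter /level /rotate_letter /collapse_letter.
  case: eqP => [_|x_ne]; first by repeat (case: ifP => ?); lia.
  by case: (boolP (i + m < x <= i + m + m)) => x_high; repeat (case: ifP => ?); lia.
have [index_out index_mid index_top] := index_rotate.
apply: (@std_word_map N w' rotate_perm level) => [x z x_gt0 xz|x z x_gt0 xz].
  by rewrite /level; repeat (case: ifP => ?); lia.
have [z_low|z_mid] := ltnP z (i + m).
  rewrite /level => same; have i_x : i <= x by move: same; repeat (case: ifP => ?); lia.
  by rewrite !index_out; [apply: low_ordered; lia | lia | lia].
rewrite /level => same; have [x_mid z_le] : i + m <= x /\ z <= i + 2 * m.
  by move: same; repeat (case: ifP => ?); lia.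
rewrite index_mid; last by lia.
have [->|z_ne] := eqVneq z (i + 2 * m); first by rewrite index_top window_high_before //; lia.
by rewrite index_mid; [apply: high_ordered; lia | lia].
Qed.

(* The descent at [i + m] moves to [i + m - 1] and a new one appears at [i + 2 * m]. *)
Lemma iblock_rotate : iblock w N < iblock w' N.
Proof.
have [i_gt0 m_gt0 low high] := spans; have [index_out index_mid index_top] := index_rotate.
have next_block : iblock w (i + 2 * m).+1 = j.+1.
  have := @iblock_homo w (i + 2 * m) (i + 2 * m).+1; have := @iblock_homo w (i + 2 * m).+1 y.
  by rewrite y_block (high (i + 2 * m)); lia.
have desc_out d : d.+1 < i + m \/ i + 2 * m < d -> idescent w d = idescent w' d.
  by move=> hd; rewrite /idescent !index_out; lia.
have desc_mid : idescent w' (i + m).-1.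
  rewrite /idescent prednK; last by lia.
  by rewrite index_mid ?index_out ?blocked_index; lia.
have desc_top : idescent w' (i + 2 * m).
  rewrite /idescent index_top index_out; last by lia.
  by apply: leq_ltn_trans y_before; apply: iblock_eq_index_le; [lia | rewrite next_block].
have start : iblock w' i = j.
  have : iblock w i + 1 = iblock w' i + 1.
    by apply: (eq_iblock_increment (x := 1)) => // d hd; apply: desc_out; lia.
  by rewrite low; lia.
have middle : j < iblock w' (i + m).
  have := @iblock_homo w' i (i + m).-1; have := @iblockS w' (i + m).-1.
  by rewrite desc_mid prednK; lia.
have next_block' : j.+1 < iblock w' (i + 2 * m).+1.
  have := @iblock_homo w' (i + m) (i + 2 * m); have := @iblockS w' (i + 2 * m).
  by rewrite desc_top; lia.
have : iblock w N + iblock w' (i + 2 * m).+1 = iblock w' N + iblock w (i + 2 * m).+1.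
  by apply: eq_iblock_increment => [||d hd]; [lia | lia | apply: desc_out; lia].
by rewrite next_block; lia.
Qed.

End EarlierOpening.

Lemma iblock_le_no_earlier_opening :
  iblock (std_word (set_nth 0 (map (collapse_letter i m) w) p i.+1)) N <= iblock w N ->
  no_earlier_opening N w (i + 2 * m) j p.
Proof.
move=> blocks_le y y_bounds y_block; rewrite ltnNge; apply/negP => y_le.
have y_before : index y w < p.
  rewrite ltn_neqAle y_le andbT; apply/eqP => index_y.
  have := nth_index_perm w_perm (x := y); rewrite index_y; have := window_letter; lia.
rewrite (std_collapse_blocked y_bounds y_block y_before) in blocks_le.
by have := iblock_rotate y_bounds y_block y_before; lia.
Qed.

End Window.

Lemma crystal_opening_before lam (w : seq nat) j p : is_partition lam ->
  perm_eq w (iota 1 (sumn lam)) -> crystal_word lam (map (iblock w) w) -> j < size lam ->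
  p < sumn lam -> nth 0 (map (iblock w) w) p = j ->
  0 < count (fun x => iblock w x == j.+1) (take p w).
Proof.
move=> lam_part w_perm w_crystal j_lt p_lt letter_p; have size_w := size_perm_iota w_perm.
have before := first_column_before lam_part w_crystal j_lt p_lt letter_p.
have q_lt := ltn_trans before p_lt.
rewrite -has_count; apply/hasP; exists (nth 0 w (cell_pos lam j 0)).
  by rewrite (mem_take_perm w_perm) (nth_perm_iota w_perm) ?(index_nth_perm w_perm).
by rewrite -(first_column lam_part w_crystal j_lt) (nth_map 0) ?size_w.
Qed.

Lemma crystal_window lam (w : seq nat) j p : is_partition lam ->
  perm_eq w (iota 1 (sumn lam)) -> crystal_word lam (map (iblock w) w) -> 0 < j < size lam ->
  f_position j (map (iblock w) w) p ->
  exists i m, [/\ spans_blocks w i m j, i + 2 * m <= sumn lam,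
    f_position i (map (collapse_letter i m) w) p,
    no_earlier_opening (sumn lam) w (i + 2 * m) j p & dyck_interval w i m].
Proof.
set N := sumn lam; move=> lam_part w_perm w_crystal /andP[j_gt0 j_lt].
move=> /[dup] -[p_lt /= /eqP letter_p _ _] /(f_position_iblock p w_perm j_gt0) unbracketed.
rewrite size_map (size_perm_iota w_perm) in p_lt.
have := crystal_opening_before lam_part w_perm w_crystal j_lt p_lt letter_p.
have blockP x : 0 < x <= N ->
    (iblock w x == j) = itv (block_end N w j.-1) (block_end N w j) x
    /\ (iblock w x == j.+1) = itv (block_end N w j) (block_end N w j.+1) x.
  by move=> hx; rewrite !(iblock_eq w_perm).
have runs := block_runs w_perm j_gt0; have hi_le := block_end_le N w j.+1.
move: (block_end N w j.-1) (block_end N w j) (block_end N w j.+1) => lo mid hi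
  in unbracketed blockP runs hi_le *.
rewrite (@eq_in_count _ _ (itv mid hi)) => [a_gt0|x /mem_take]; last first.
  by rewrite (mem_perm_iota w_perm) => /blockP[].
have [lo_x mid_x] := rightmost_unbracketed_bounds w_perm runs unbracketed.
have [_ x_low _ _] := unbracketed; rewrite /itv in x_low.
have [i i_E] : exists i, i + count (itv mid hi) (take p w) = nth 0 w p.
  by exists (nth 0 w p - count (itv mid hi) (take p w)); lia.
have [m m_E] : exists m, i + m = mid by exists (mid - i); lia.
have [lo_i m_hi a_m] := shrink_bounds w_perm runs i_E m_E unbracketed.
have window := rightmost_unbracketed_shrink w_perm runs i_E m_E unbracketed.
have heights := shrink_heights w_perm runs i_E m_E unbracketed.
have beyond := shrink_beyond w_perm runs i_E m_E unbracketed.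
have [_ _ _ low_ordered high_ordered] := runs.
rewrite -m_E in blockP m_hi window heights beyond low_ordered high_ordered.
have m_gt0 := leq_trans a_gt0 a_m; have i_gt0 : 0 < i by lia.
exists i, m; split.
- split=> // x hx; apply/eqP; have [|blockE blockSE] := blockP x; try lia.
    by rewrite blockE /itv; lia.
  by rewrite blockSE /itv; lia.
- by lia.
- exact/(f_position_collapse p w_perm).
- move=> y hy /eqP y_block; apply: beyond; move: y_block.
  by have [|_ ->] := blockP y; rewrite /itv; lia.
- apply: (dyck_intervalI w_perm) => //; first by lia.
    by apply: in_order_sub low_ordered; lia.
  by apply: in_order_sub high_ordered; lia.
Qed.

Section Edges.

Variable lam : seq nat.
Hypotheses (lam_part : is_partition lam) (lam_gt0 : 0 < size lam).
Let N := sumn lam.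
Let N_gt0 : 0 < N := sumn_partition_gt0 lam_part lam_gt0.

Lemma spans_blocks_subset T i m j : is_SYT lam T -> i + 2 * m <= N ->
  spans_blocks (rowword T) i m j ->
  {subset iota i m.+1 <= block (Des T) j} /\ {subset iota (i + m).+1 m <= block (Des T) j.+1}.
Proof.
move=> T_syt im_le spans; have [i_gt0 m_gt0 low high] := spans.
have j_gt0 := spans_blocks_gt0 spans; split=> x; rewrite mem_iota => hx.
  by rewrite (mem_block lam_part T_syt N_gt0) // ?low // -/N; lia.
by rewrite (mem_block lam_part T_syt N_gt0) // ?high // -/N; lia.
Qed.

Lemma spans_blocks_bounds T i m j : T \in CSvert lam -> i + 2 * m <= N ->
  spans_blocks (rowword T) i m j -> 0 < j < size lam.
Proof.
move=> /(CSvertP lam_part lam_gt0)[_ <-] im_le spans; rewrite (spans_blocks_gt0 spans).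
have [i_gt0 m_gt0 _ high] := spans; rewrite -(high (i + m).+1); last by lia.
by apply: iblock_homo; rewrite -/N; lia.
Qed.

(* [collapse i m T] and [phi T] change at the same position [p], and the results have the same
   standardization. *)
Lemma collapse_crystal_edge T i m j p : T \in CSvert lam ->
  spans_blocks (rowword T) i m j -> i + 2 * m <= N ->
  f_position i (map (collapse_letter i m) (rowword T)) p ->
  no_earlier_opening N (rowword T) (i + 2 * m) j p ->
  exists b c, [/\ f_tab j (phi T) = Some b, f_tab i (collapse i m T) = Some c,
    std_tab b = std_tab c & b \in Bvert lam].
Proof.
move=> T_vert spans im_le p_collapse no_earlier.
have /(CSvertP lam_part lam_gt0)[T_syt _] := T_vert.
have [_ phi_crystal] := proj1 (BvertP lam_part _) (phi_Bvert lam_part lam_gt0 T_vert).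
have w_perm := syt_perm T_syt; have phi_word := rowword_phi lam_part T_syt N_gt0.
rewrite phi_word in phi_crystal.
have p_phi := f_position_uncollapse w_perm spans im_le p_collapse no_earlier.
have /andP[_ j_lt] := spans_blocks_bounds T_vert im_le spans.
have f_crystal := crystal_word_f lam_part phi_crystal j_lt p_phi.
have size_collapse : size (set_nth 0 (map (collapse_letter i m) (rowword T)) p i.+1) = N.
  rewrite size_set_nth size_map (size_perm_iota w_perm).
  exact/maxn_idPr/(window_position_lt w_perm p_collapse).
have [size_f _ _] := f_crystal.
exists (tab_of_word lam (set_nth 0 (map (iblock (rowword T)) (rowword T)) p j.+1)).
exists (tab_of_word lam (set_nth 0 (map (collapse_letter i m) (rowword T)) p i.+1)); split.
- by rewrite (@f_tabE _ _ p) ?phi_word ?(shape_phi T_syt).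
- by rewrite (@f_tabE _ _ p) rowword_collapse // shape_map (syt_shape T_syt).
- rewrite /std_tab !shape_tab_of_word ?tab_of_wordK //.
  by rewrite (std_collapse w_perm spans im_le p_collapse no_earlier).
- exact: tab_of_word_Bvert.
Qed.

Lemma cs_edge_crystal T T' i m : T \in CSvert lam -> T' \in CSvert lam -> cs_edge T i m T' ->
  exists j, [/\ 0 < j < size lam, {subset iota i m.+1 <= block (Des T) j},
    {subset iota (i + m).+1 m <= block (Des T) j.+1} & f_tab j (phi T) = Some (phi T')].
Proof.
move=> T_vert T'_vert [dyck [c c_edge T'_E]].
have /(CSvertP lam_part lam_gt0)[T_syt last_block] := T_vert.
have /(CSvertP lam_part lam_gt0)[_ last_block'] := T'_vert.
have w_perm := syt_perm T_syt; have spans := dyck_interval_spans (uniq_perm_iota w_perm) dyck.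
have im_le : i + 2 * m <= N by case/and4P: dyck; rewrite (size_perm_iota w_perm).
have [p p_collapse c_E] := f_tabP c_edge.
have word_T' : rowword T' = std_word (set_nth 0 (rowword (collapse i m T)) p i.+1).
  rewrite -T'_E rowword_std_tab c_E tab_of_wordK // size_set_nth -size_rowword.
  by have [/maxn_idPr] := p_collapse.
rewrite rowword_collapse in p_collapse word_T'.
have beyond : no_earlier_opening N (rowword T) (i + 2 * m) (iblock (rowword T) i) p.
  apply: (iblock_le_no_earlier_opening w_perm spans im_le p_collapse).
  by rewrite -word_T' last_block last_block'.
have [b [c' [b_edge c'_edge std_bc b_vert]]] :=
  collapse_crystal_edge T_vert spans im_le p_collapse beyond.
have [low_block high_block] := spans_blocks_subset T_syt im_le spans.
exists (iblock (rowword T) i); split=> //; first exact: spans_blocks_bounds spans.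
rewrite b_edge -T'_E; move: c'_edge; rewrite c_edge => -[->].
by rewrite -std_bc (std_tabK lam_part lam_gt0).
Qed.

Lemma crystal_cs_edge T j b : T \in CSvert lam -> 0 < j < size lam ->
  f_tab j (phi T) = Some b ->
  exists T' i m, [/\ T' \in CSvert lam, cs_edge T i m T', phi T' = b,
    {subset iota i m.+1 <= block (Des T) j} & {subset iota (i + m).+1 m <= block (Des T) j.+1}].
Proof.
move=> T_vert j_bounds b_edge; have [p p_phi _] := f_tabP b_edge.
have /(CSvertP lam_part lam_gt0)[T_syt _] := T_vert.
have [_ phi_crystal] := proj1 (BvertP lam_part _) (phi_Bvert lam_part lam_gt0 T_vert).
rewrite (rowword_phi lam_part T_syt N_gt0) in p_phi phi_crystal.
have [i [m [spans im_le p_collapse beyond dyck]]] :=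
  crystal_window lam_part (syt_perm T_syt) phi_crystal j_bounds p_phi.
have [b' [c [b'_edge c_edge std_bc b'_vert]]] :=
  collapse_crystal_edge T_vert spans im_le p_collapse beyond.
have [low_block high_block] := spans_blocks_subset T_syt im_le spans.
have b_E : b = b' by move: b'_edge; rewrite b_edge => -[].
exists (std_tab b), i, m; rewrite b_E (std_tabK lam_part lam_gt0) //; split=> //.
  exact: std_tab_CSvert.
by split=> //; exists c.
Qed.

End Edges.

Lemma CSvert_nil T : T \in CSvert [::] -> T = [::].
Proof. by rewrite inE /= => /andP[/and3P[/eqP]]; case: T. Qed.

Lemma Bvert_nil b : b \in Bvert [::] -> b = [::].
Proof. by rewrite inE /= => /and3P[/eqP]; case: b. Qed.

Theorem theorem4p37 (lam : seq nat) :
  is_partition lam ->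
  [/\ (* phi is a bijection CS(lam)_l -> B(lam)_l on vertices *)
      (forall T, T \in CSvert lam -> phi T \in Bvert lam),
      {in CSvert lam &, injective phi},
      (forall b, b \in Bvert lam -> exists2 T, T \in CSvert lam & phi T = b),
      (* every edge of the induced subgraph becomes the crystal edge with label j *)
      (forall T T' i m, T \in CSvert lam -> T' \in CSvert lam ->
         cs_edge T i m T' ->
         exists j, [/\ 0 < j < size lam,
                       {subset iota i m.+1 <= block (Des T) j},
                       {subset iota (i + m).+1 m <= block (Des T) j.+1} &
                       f_tab j (phi T) = Some (phi T')]) &
      (* every crystal edge of B(lam)_l comes from such an edge *)
      (forall T j b', T \in CSvert lam -> 0 < j < size lam ->
         f_tab j (phi T) = Some b' ->
         exists T' i m, [/\ T' \in CSvert lam, cs_edge T i m T', phi T' = b',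
                           {subset iota i m.+1 <= block (Des T) j} &
                           {subset iota (i + m).+1 m <= block (Des T) j.+1}])].
Proof.
move=> lam_part; have [/size0nil ->|lam_gt0] := posnP (size lam).
  split=> //.
  - by move=> T /CSvert_nil ->.
  - by move=> T T' /CSvert_nil -> /CSvert_nil ->.
  - by move=> b /Bvert_nil ->; exists [::].
  - by move=> T T' i m /CSvert_nil -> _ [/and4P[m_gt0 i_gt0 im_le _]]; move: im_le => /=; lia.
  - by move=> T j b' _ /=; lia.
split.
- exact: phi_Bvert.
- exact: can_in_inj (phiK lam_part lam_gt0).
- move=> b b_vert; exists (std_tab b); first exact: std_tab_CSvert.
  exact: (std_tabK lam_part lam_gt0).
- exact: cs_edge_crystal.
- exact: crystal_cs_edge.
Qed.
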